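(* Let $1\le p,q,u,v\le\infty$. Then there exist constants $0<c_0<1$ and $c_1,\dots,c_6>0$ such that for all $n,N_1,N_2\in\mathbb{N}$ with $n<c_0N_1N_2$ the following hold. Write $F=B_{L_p^{N_1}(L_u^{N_2})}$ and $G=L_q^{N_1}(L_v^{N_2})$. If $p\ge q$ or $u\le v$, then $$c_1N_1^{(1/p-1/q)_+}N_2^{(1/u-1/v)_+}\le e_n^{\rm ran}\big(J^{N_1,N_2},F,G\big)\le e_n^{\rm ran\text{-}non}\big(J^{N_1,N_2},F,G\big)\le c_2N_1^{(1/p-1/q)_+}N_2^{(1/u-1/v)_+}.$$ If $p<q$ and $u>v$, then $$c_3N_1^{1/p-1/q}\Bigg(\left\lceil\frac{n}{N_1}\right\rceil^{1/u-1/v}+\left\lceil\frac{n}{N_2}\right\rceil^{1/q-1/p}\Bigg)\le e_n^{\rm ran}\big(J^{N_1,N_2},F,G\big)$$ $$\le c_4N_1^{1/p-1/q}\Bigg(\left\lceil\frac{n}{N_1\log(N_1+N_2)}\right\rceil^{1/u-1/v}+\left\lceil\frac{n}{N_2\log(N_1+N_2)}\right\rceil^{1/q-1/p}\Bigg)$$ and $$c_5N_1^{1/p-1/q}\le e_n^{\rm ran\text{-}non}\big(J^{N_1,N_2},F,G\big)\le c_6N_1^{1/p-1/q}.$$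
   Context: Conventions. $\mathbb{N}=\{1,2,\dots\}$, $\mathbb{N}_0=\mathbb{N}\cup\{0\}$; $\mathbb{K}$ is $\mathbb{R}$ or $\mathbb{C}$; $\log=\log_2$; $a_+=\max(a,0)$; $1/\infty=0$; $B_X$ is the unit ball of a normed space $X$. Spaces. $L_p^N$ is the space of all $f:\{1,\dots,N\}\to\mathbb{K}$ with norm $\|f\|_{L_p^N}=\big(\frac1N\sum_{i=1}^N|f(i)|^p\big)^{1/p}$ for $p<\infty$ and $\|f\|_{L_\infty^N}=\max_i|f(i)|$. $L_p^{N_1}(L_u^{N_2})$ is the space of all $f:\{1,\dots,N_1\}\times\{1,\dots,N_2\}\to\mathbb{K}$ with norm $\big\|(\|f_i\|_{L_u^{N_2}})_{i=1}^{N_1}\big\|_{L_p^{N_1}}$, where $f_i=(f(i,j))_{j=1}^{N_2}$. The solution operator is the identity map $J^{N_1,N_2}:L_p^{N_1}(L_u^{N_2})\to L_q^{N_1}(L_v^{N_2})$, $J^{N_1,N_2}f=f$. Problem. The input set is $F=B_{L_p^{N_1}(L_u^{N_2})}$, the target space is $G=L_q^{N_1}(L_v^{N_2})$, the solution operator is $S=J^{N_1,N_2}$ (restricted to $F$), and the set of information functionals is $\Lambda=\{\delta_{ij}:1\le i\le N_1,\,1\le j\le N_2\}$, $\delta_{ij}(f)=f(i,j)$, with values in $K=\mathbb{K}$. Deterministic algorithms. A deterministic algorithm is a tuple $A=((L_i)_{i=1}^\infty,(\tau_i)_{i=0}^\infty,(\varphi_i)_{i=0}^\infty)$ with $L_1\in\Lambda$,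 $\tau_0\in\{0,1\}$, $\varphi_0\in G$, and, for $i\in\mathbb{N}$, arbitrary mappings $L_{i+1}:K^i\to\Lambda$, $\tau_i:K^i\to\{0,1\}$, $\varphi_i:K^i\to G$. For $f\in F$ put $\lambda_1=L_1$, $\lambda_i=L_i(\lambda_1(f),\dots,\lambda_{i-1}(f))$ for $i\ge2$. The cardinality ${\rm card}(A,f)$ is $0$ if $\tau_0=1$; if $\tau_0=0$ it is the first integer $n\ge1$ with $\tau_n(\lambda_1(f),\dots,\lambda_n(f))=1$, or $+\infty$ if there is none. The output is $A(f)=\varphi_0$ if ${\rm card}(A,f)\in\{0,\infty\}$, and $A(f)=\varphi_n(\lambda_1(f),\dots,\lambda_n(f))$ if $1\le{\rm card}(A,f)=n<\infty$. $A$ is non-adaptive if all $L_i$ and all $\tau_i$ are constant. Randomized algorithms. A randomized algorithm is $A=((\Omega,\Sigma,\mathbb{P}),(A_\omega)_{\omega\in\Omega})$ with $(\Omega,\Sigma,\mathbb{P})$ a probability space and each $A_\omega$ a deterministic algorithm. $\mathscr{A}_n^{\rm ran}$ ($n\in\mathbb{N}_0$) is the class of randomized algorithms such that for each $f\in F$ the map $\omega\mapsto{\rm card}(A_\omega,f)$ is $\Sigma$-measurable, $\mathbb{E}\,{\rm card}(A_\omega,f)\le n$, and $\omega\mapsto A_\omega(f)$ is $\Sigma$-to-Borel measurable and $\mathbb{P}$-almost surely separably valued. $\mathscr{A}_n^{\rm ran\text{-}non}$ is the subset of those for which $A_\omega$ is non-adaptive for all $\omega\in\Omega$. Minimal errors.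 $e_n^{\rm ran}(S,F,G)=\inf_{A\in\mathscr{A}_n^{\rm ran}}\sup_{f\in F}\mathbb{E}\,\|S(f)-A_\omega(f)\|_G$, and $e_n^{\rm ran\text{-}non}(S,F,G)$ is defined in the same way with the infimum over $\mathscr{A}_n^{\rm ran\text{-}non}$. The constants may depend on $p,q,u,v$ but not on $n,N_1,N_2$. *)

(* Defs.v *)
From HB Require Import structures.
From mathcomp Require Import all_boot all_order all_algebra.
From mathcomp Require Import all_classical all_reals all_analysis measurable_realfun.
From mathcomp.real_closed Require Import complex.

Set Implicit Arguments.
Unset Strict Implicit.
Unset Printing Implicit Defensive.

Import Order.TTheory GRing.Theory Num.Theory.
Local Open Scope classical_set_scope.
Local Open Scope ring_scope.

Variant base_field := RealField | ComplexField.

Definition scalar (R : realType) (k : base_field) : fieldType :=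
  match k with RealField => R | ComplexField => R[i] end.

(* The norm of the numFieldType R[i] takes its values in R[i], whence normc. *)
Definition modulus (R : realType) (k : base_field) : scalar R k -> R :=
  match k with
  | RealField => fun x : R => `|x|
  | ComplexField => fun z : R[i] => Normc.normc z
  end.

Section NormedTarget.
Context {R : realType} {G : zmodType} (normG : G -> R).

Definition norm_open (U : set G) : Prop :=
  forall g, U g -> exists2 e : R, 0 < e & forall h, normG (h - g) < e -> U h.

Definition norm_borel : set (set G) := <<s norm_open >>.

Definition norm_separable (T : set G) : Prop :=
  exists D : set G, [/\ countable D, D `<=` T &
    forall g, T g -> forall e : R, 0 < e -> exists2 d, D d & normG (g - d) < e].

End NormedTarget.

Section Algorithms.
Context {R : realType} {X K : Type} {G : zmodType} (normG : G -> R).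
Context (F : set X) (S : X -> G) (Lambda : set (X -> K)).

(* query i is the choice of the (i+1)-st functional from the first i values;
   at i = 0 the argument ranges over the one-point type 0.-tuple K, so that
   query 0, terminate 0 and output 0 are constants. *)
Record det_algorithm := DetAlgorithm {
  query : forall i : nat, i.-tuple K -> X -> K ;
  query_adm : forall (i : nat) (y : i.-tuple K), Lambda (query y) ;
  terminate : forall i : nat, i.-tuple K -> bool ;
  output : forall i : nat, i.-tuple K -> G
}.

Fixpoint info (A : det_algorithm) (f : X) (n : nat) : n.-tuple K :=
  match n with
  | 0 => [tuple]
  | m.+1 => [tuple of rcons (info A f m) (query A (info A f m) f)]
  end.

(* None if the algorithm never terminates. *)
Definition stop_time (A : det_algorithm) (f : X) : option nat :=
  match pselect (exists n, terminate A (info A f n)) with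
  | left h => Some (ex_minn h)
  | right _ => None
  end.

Definition card (A : det_algorithm) (f : X) : \bar R :=
  if stop_time A f is Some n then n%:R%:E else +oo%E.

Definition run (A : det_algorithm) (f : X) : G :=
  output A (info A f (odflt 0%N (stop_time A f))).

Definition non_adaptive (A : det_algorithm) : Prop :=
  (forall i (y z : i.-tuple K), query A y = query A z) /\
  (forall i (y z : i.-tuple K), terminate A y = terminate A z).

Record ran_algorithm := RanAlgorithm {
  ran_disp : measure_display ;
  sample : measurableType ran_disp ;
  law : probability sample R ;
  realization : sample -> det_algorithm
}.
Arguments realization : clear implicits.

(* ran_algorithm lies in too large a universe to be the carrier of a set. *)
Definition ran_class (n : nat) (A : ran_algorithm) : Prop := forall f, F f ->
  [/\ measurable_fun [set: sample A] (fun w => card (realization A w) f),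
      (\int[law A]_w card (realization A w) f <= n%:R%:E)%E,
      forall B, norm_borel normG B ->
        measurable [set w | B (run (realization A w) f)] &
      exists2 T : set G, norm_separable normG T &
        {ae law A, forall w, T (run (realization A w) f)}].

Definition ran_non_class (n : nat) (A : ran_algorithm) : Prop :=
  ran_class n A /\ forall w, non_adaptive (realization A w).

Definition ran_error (A : ran_algorithm) : \bar R :=
  ereal_sup [set (\int[law A]_w (normG (S f - run (realization A w) f))%:E)%E
            | f in F].

Definition e_ran (n : nat) : \bar R :=
  ereal_inf [set e | exists2 A, ran_class n A & ran_error A = e].

Definition e_ran_non (n : nat) : \bar R :=
  ereal_inf [set e | exists2 A, ran_non_class n A & ran_error A = e].

End Algorithms.

(* The case p = -oo is junk: exponents are used in the range [1, +oo]. *)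
Definition lpnorm (R : realType) (k : base_field) (N : nat) (p : \bar R)
    (x : 'I_N -> scalar R k) : R :=
  match p with
  | EFin r => (N%:R^-1 * \sum_(i < N) modulus (x i) `^ r) `^ r^-1
  | EPInf => \big[Num.max/0]_(i < N) modulus (x i)
  | ENInf => 0
  end.

Definition mixed_norm (R : realType) (k : base_field) (N1 N2 : nat)
    (p u : \bar R) (f : 'M[scalar R k]_(N1, N2)) : R :=
  @lpnorm R RealField N1 p (fun i => lpnorm u (fun j => f i j)).

Definition unit_ball (R : realType) (k : base_field) (N1 N2 : nat)
    (p u : \bar R) : set 'M[scalar R k]_(N1, N2) :=
  [set f | mixed_norm p u f <= 1].

Definition point_evaluations (K : Type) (N1 N2 : nat) :
    set ('M[K]_(N1, N2) -> K) :=
  [set delta | exists i j, delta = fun f : 'M[K]_(N1, N2) => f i j].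

(* idfun is the solution operator, from L_p(L_u) to L_q(L_v). *)
Definition e_ran_J (R : realType) (k : base_field) (p q u v : \bar R)
    (n N1 N2 : nat) : \bar R :=
  e_ran (mixed_norm q v) (@unit_ball R k N1 N2 p u) idfun
    (@point_evaluations (scalar R k) N1 N2) n.

Definition e_ran_non_J (R : realType) (k : base_field) (p q u v : \bar R)
    (n N1 N2 : nat) : \bar R :=
  e_ran_non (mixed_norm q v) (@unit_ball R k N1 N2 p u) idfun
    (@point_evaluations (scalar R k) N1 N2) n.

(* inv_exp +oo = 0 *)
Definition inv_exp (R : realType) (p : \bar R) : R := fine p^-1%E.

Definition pos_part (R : realType) (a : R) : R := Num.max a 0.

Definition log2 (R : realType) (x : R) : R := ln x / ln 2.

Definition rceil (R : realType) (x : R) : R := (Num.ceil x)%:~R.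

(* Main.v *)
From HB Require Import structures.
Require Import Defs.
From mathcomp Require Import all_boot all_order all_algebra.
From mathcomp Require Import all_classical all_reals all_analysis measurable_realfun.
From mathcomp.real_closed Require Import complex.
From mathcomp Require Import ring lra.
Set Implicit Arguments.
Unset Strict Implicit.
Unset Printing Implicit Defensive.
Import Order.TTheory GRing.Theory Num.Theory.
Local Open Scope ring_scope.

(** Write a = 1/p - 1/q and b = 1/u - 1/v.

    Lower bounds. By Yao's principle (averaging) it suffices to bound the average
    error of a deterministic algorithm over a finite family of inputs of the unit
    ball. All families have the same shape: independent components, each of
    which sits in one of several disjoint cells of entries with the value + c or
    - c, or is switched off. What is outside the touched entries cannot be seen
    (touched_local): where the algorithm has not looked, it gives the same answer
    for + c, for - c and for the input with the component switched off, and so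
    errs by c on average. The latter input is itself in the family, so the search
    for a component is paid for by the cardinality of the algorithm there, even if
    the search is adaptive (cost_component, fooling). When the components fill a
    pattern of k rows with d entries each, the unit ball permits
    c = (N1/k)^(1/p) (N2/d)^(1/u), and the error is of order (N1/k)^a (N2/d)^b as
    long as n is at most a sixth of the total number of cells (e_ran_lower). The
    choices (k, d) = (N1, N2), (N1, 1) and (1, 1) give the norm of the embedding,
    up to a constant, in the first case of the theorem. In the second case, d of
    order N2 N1 / n with k = 1, and k of order n / N2 with d = N2, give the two
    terms. Against a non-adaptive algorithm one full row suffices, because on
    average the algorithm spends n / N1 entries on it (e_ran_non_lower).

    Upper bounds. The output 0 has the norm of the embedding as its error. In the
    second case the adaptive algorithm first estimates, from s random entries per
    row and h times independently, the v-norm of each row, then reads completely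
    the rows for which all h estimates exceed a threshold th, and puts 0
    elsewhere. By Markov's inequality for the h estimates with h at least p, the
    expected number of rows read is at most N1 th^(-p), which is n / (2 N2) for a
    suitable th. Given X > 0, since u > v, the part of a row above a suitable
    level carries at most half of the mean of |f|^v unless the v-norm of the row
    is at most of order (s/X)^b times the u-norm; a Chernoff bound for the
    truncated row then shows that a row which is neither small in this sense nor
    below a multiple of th fails to be selected with probability at most
    h 2^(- X) (sampling_misses_rarely). With X of the order of log (N1 + N2) it is
    unlikely that any such row is missed. The rows left out then contribute
    th^(1 - p/q), by interpolation between the p-norm and the supremum, and
    (s/X)^b N1^a, by the embedding of the u-norms (residual_small). Expressed in
    n, these are the two terms of the bound. *)

(** * Real powers *)

Section Power.
Context {R : realType}.
Implicit Types (x y r t a b e f m : R).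

Lemma ler_powR2 a x y : 0 <= a -> 0 <= x -> x <= y -> x `^ a <= y `^ a.
Proof.
move=> a0 x0 xy; apply: ge0_ler_powR => //; rewrite nnegrE //.
exact: le_trans xy.
Qed.

Lemma powR_le1 a x : 0 <= a -> 0 <= x -> x <= 1 -> x `^ a <= 1.
Proof.
move=> a0 x0 x1; have -> : 1 = 1 `^ a :> R by rewrite powR1.
exact: ler_powR2.
Qed.

Lemma powRVK r x : 0 < r -> 0 <= x -> (x `^ r) `^ r^-1 = x.
Proof. by move=> r0 x0; rewrite -powRrM mulfV ?gt_eqF// powRr1. Qed.

Lemma powRKV r x : 0 < r -> 0 <= x -> (x `^ r^-1) `^ r = x.
Proof. by move=> r0 x0; rewrite -powRrM mulVf ?gt_eqF// powRr1. Qed.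

Lemma powRV x a : 0 <= x -> x^-1 `^ a = (x `^ a)^-1.
Proof. by move=> x0; rewrite -powR_inv1// -powRrM mulN1r powRN. Qed.

Lemma ler_npowR e x y : e <= 0 -> 0 < x -> x <= y ->
  y `^ e <= x `^ e.
Proof.
move=> e0 x0 xy; have y0 := lt_le_trans x0 xy.
rewrite -[e]opprK !(powRN _ (- e)) lef_pV2 ?posrE ?powR_gt0//.
by apply: ler_powR2 => //; [rewrite oppr_ge0|apply: ltW].
Qed.

(** The loss is at most the factor m because the exponent is at least -1. *)
Lemma ler_powR_scale x y m e : 0 < x -> 0 < y -> 1 <= m ->
  y <= m * x -> -1 <= e -> e <= 0 -> x `^ e <= m * y `^ e.
Proof.
move=> x0 y0 m1 ymx e1 e0; have m0 : 0 < m by apply: lt_le_trans m1.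
apply: (@le_trans _ _ (m * (m * x) `^ e)); last first.
  by rewrite ler_pM2l//; apply: ler_npowR.
rewrite powRM ?(ltW m0) ?(ltW x0)// mulrA ler_peMl ?powR_ge0//.
rewrite -[m in m * _](powRr1 (ltW m0)) -powRD; last by rewrite (gt_eqF m0) implybT.
by rewrite -[leLHS](powRr0 m); apply: ler_powR => //; lra.
Qed.

Lemma powR_divB x y e f : 0 < x -> 0 < y ->
  (x / y) `^ e * (y / x) `^ f = (x / y) `^ (e - f).
Proof.
move=> x0 y0; have xy : 0 < x / y by rewrite divr_gt0.
rewrite powRB; last by rewrite (gt_eqF xy) implybT.
by rewrite -[y / x]invf_div powRV ?ltW.
Qed.

Lemma powR_lin_conv r t x y : 1 <= r -> 0 <= t <= 1 -> 0 <= x -> 0 <= y ->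
  (t * x + (1 - t) * y) `^ r <= t * x `^ r + (1 - t) * y `^ r.
Proof.
move=> r1 /andP[t0 t1] x0 y0.
have := @convex_powR R r r1 (Itv01 t0 t1) x y.
rewrite !inE /= !in_itv /= !andbT => /(_ x0 y0).
by rewrite !convRE.
Qed.

(** The tangent line of the power at 1, read off from Young's inequality with
    second factor 1. *)
Lemma bernoulli_powR r x : 1 <= r -> 0 <= x -> r * x <= x `^ r + (r - 1).
Proof.
move=> r1 x0; have r0 : 0 < r by apply: lt_le_trans r1.
have [->|rn1] := eqVneq r 1; first by rewrite powRr1// subrr addr0 mul1r.
have r1' : 0 < r - 1 by rewrite subr_gt0 lt_neqAle eq_sym rn1.
have := @conjugate_powR R x 1 r (r / (r - 1)) x0 ler01 r0.
rewrite divr_gt0// => /(_ isT).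
have -> : r^-1 + (r / (r - 1))^-1 = 1.
  by rewrite invf_div; field; rewrite gt_eqF.
move=> /(_ erefl); rewrite mulr1 powR1 => h.
have : r * x <= r * (x `^ r / r + 1 / (r / (r - 1))) by rewrite ler_pM2l.
congr (_ <= _); field; apply/andP; split; rewrite gt_eqF//.
Qed.

(** Summing the tangent inequality at the mean. *)
Lemma jensen_powR (I : finType) (A : {set I}) (x : I -> R) r :
  1 <= r -> (0 < #|A|)%N -> (forall i, 0 <= x i) ->
  (#|A|%:R^-1 * \sum_(i in A) x i) `^ r
    <= #|A|%:R^-1 * \sum_(i in A) x i `^ r.
Proof.
move=> r1 A0 x0; have r0 : 0 < r by apply: lt_le_trans r1.
set k := #|A|%:R; have k0 : 0 < k :> R by rewrite ltr0n.
set m := k^-1 * _.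
have m0 : 0 <= m by rewrite mulr_ge0 ?invr_ge0 ?(ltW k0)// sumr_ge0.
have [->|mn0] := eqVneq m 0.
  rewrite powR0 ?gt_eqF// mulr_ge0 ?invr_ge0 ?(ltW k0)// sumr_ge0// => i _.
  exact: powR_ge0.
have mp : 0 < m by rewrite lt_neqAle eq_sym mn0.
rewrite mulrC ler_pdivlMr//.
have -> : \sum_(i in A) x i `^ r = m `^ r * \sum_(i in A) (x i / m) `^ r.
  rewrite mulr_sumr; apply: eq_bigr => i _.
  by rewrite -powRM ?divr_ge0// mulrC divfK.
apply: ler_wpM2l; first exact: powR_ge0.
have : \sum_(i in A) r * (x i / m) <= \sum_(i in A) ((x i / m) `^ r + (r - 1)).
  by apply: ler_sum => i _; apply: bernoulli_powR => //; rewrite divr_ge0.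
rewrite -mulr_sumr -mulr_suml big_split /= sumr_const -mulr_natr -/k.
have -> : (\sum_(i in A) x i) / m = k.
  have -> : \sum_(i in A) x i = k * m by rewrite mulrA mulfV ?mul1r// gt_eqF.
  by rewrite mulfK.
by lra.
Qed.

End Power.

(** * Normalized l_p norms of nonnegative sequences *)

Section LpMean.
Context {R : realType}.
Implicit Types (p q u v : \bar R).

(** Norms see a function only through its moduli, so one theory of nonnegative
    real sequences serves both scalar fields and both levels of a mixed norm. *)
Definition lp (N : nat) p (x : 'I_N -> R) : R :=
  match p with
  | EFin r => (N%:R^-1 * \sum_(i < N) x i `^ r) `^ r^-1
  | EPInf => \big[Num.max/0]_(i < N) x i
  | ENInf => 0
  end.

Lemma lpnormE k N p (x : 'I_N -> Defs.scalar R k) :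
  lpnorm p x = lp p (fun i => modulus (x i)).
Proof. by []. Qed.

Lemma inv_expE (r : R) : inv_exp r%:E = r^-1.
Proof.
rewrite /inv_exp /=; have [->|r0] := eqVneq r 0; last by rewrite inver (negbTE r0).
by rewrite inver eqxx /= invr0.
Qed.

Lemma inv_expy : inv_exp +oo%E = 0 :> R.
Proof. by rewrite /inv_exp invey. Qed.

Lemma exponentP p : (1 <= p)%E ->
  (exists2 r, p = r%:E & 1 <= r) \/ p = +oo%E.
Proof. by case: p => [r||] //; [rewrite lee_fin; left; exists r|right]. Qed.

Lemma inv_exp_itv p : (1 <= p)%E -> 0 <= inv_exp p <= 1.
Proof.
move=> /exponentP[[r -> r1]|->]; last by rewrite inv_expy lexx ler01.
by rewrite inv_expE invr_ge0 (le_trans ler01 r1) invf_le1// (lt_le_trans _ r1).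
Qed.

Lemma inv_exp_le p q : (1 <= p)%E -> (p <= q)%E -> inv_exp q <= inv_exp p.
Proof.
move=> p1 pq; have q1 := le_trans p1 pq; move: q1 p1 pq.
move=> /exponentP[[s -> s1]|->] /exponentP[[r -> r1]|->] //; last first.
  by move=> _; rewrite inv_expy inv_expE invr_ge0 (le_trans ler01).
rewrite lee_fin => rs; rewrite !inv_expE.
by rewrite lef_pV2 // posrE; [apply: lt_le_trans s1|apply: lt_le_trans r1].
Qed.

Lemma inv_exp_sub_itv p q : (1 <= p)%E -> (p <= q)%E ->
  0 <= inv_exp p - inv_exp q <= 1.
Proof.
move=> p1 pq; have q1 := le_trans p1 pq.
have /andP[_ y] := inv_exp_itv p1; have /andP[z _] := inv_exp_itv q1.
by rewrite subr_ge0 inv_exp_le//=; lra.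
Qed.

Lemma lp_ge0 N p (x : 'I_N -> R) : 0 <= lp p x.
Proof.
case: p => [r||] //=; first exact: powR_ge0.
by elim/big_rec: _ => // i a _ a0; rewrite le_max a0 orbT.
Qed.

Lemma lp_pow N (r : R) (x : 'I_N -> R) : 1 <= r -> (forall i, 0 <= x i) ->
  lp r%:E x `^ r = N%:R^-1 * \sum_(i < N) x i `^ r.
Proof.
move=> r1 x0 /=; rewrite powRKV//; first exact: lt_le_trans r1.
by rewrite mulr_ge0 ?invr_ge0// sumr_ge0// => i _; apply: powR_ge0.
Qed.

Lemma lpy_ub N (x : 'I_N -> R) i : x i <= lp +oo%E x.
Proof. by rewrite /lp (bigD1 i) //= le_max lexx. Qed.

Lemma lpy_le N (x : 'I_N -> R) c : 0 <= c -> (forall i, x i <= c) ->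
  lp +oo%E x <= c.
Proof.
by move=> c0 xc /=; elim/big_rec: _ => // i a _ ac; rewrite ge_max xc ac.
Qed.

Lemma lp_le N p (x y : 'I_N -> R) : (1 <= p)%E -> (forall i, 0 <= x i) ->
  (forall i, x i <= y i) -> lp p x <= lp p y.
Proof.
move=> /exponentP[[r -> r1]|->] x0 xy.
  apply: ler_powR2; first by rewrite invr_ge0 (le_trans ler01 r1).
    by rewrite mulr_ge0 ?invr_ge0// sumr_ge0// => i _; apply: powR_ge0.
  apply: ler_wpM2l; first by rewrite invr_ge0.
  apply: ler_sum => i _; apply: ler_powR2 => //; exact: le_trans r1.
apply: lpy_le; first exact: lp_ge0.
by move=> i; apply: le_trans (xy i) _; apply: lpy_ub.
Qed.

Lemma lp_scale N p (c : R) (x : 'I_N -> R) : (1 <= p)%E -> 0 <= c ->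
  (forall i, 0 <= x i) -> lp p (fun i => c * x i) = c * lp p x.
Proof.
move=> /exponentP[[r -> r1]|->] c0 x0 /=.
  have r0 : 0 < r by apply: lt_le_trans r1.
  under eq_bigr do rewrite powRM//.
  rewrite -mulr_sumr mulrCA powRM ?powR_ge0 ?powRVK//.
  by rewrite mulr_ge0 ?invr_ge0// sumr_ge0// => i _; apply: powR_ge0.
elim/big_rec2: _ => [|i a b _ ->]; first by rewrite mulr0.
by rewrite maxr_pMr.
Qed.

Lemma lp_le_of_mean N (r A : R) (x : 'I_N -> R) : 1 <= r -> 0 <= A ->
  (forall i, 0 <= x i) ->
  N%:R^-1 * \sum_(i < N) x i `^ r <= A `^ r -> lp r%:E x <= A.
Proof.
move=> r1 A0 x0 h; have r0 : 0 < r by apply: lt_le_trans r1.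
rewrite -[leRHS](@powRVK _ r)//; apply: ler_powR2 => //.
  by rewrite invr_ge0 ltW.
by rewrite mulr_ge0 ?invr_ge0// sumr_ge0// => i _; apply: powR_ge0.
Qed.

(** Minkowski's inequality by convexity: (x + y) / (A + B) is a convex combination
    of x / A and y / B. Positive bounds A and B in place of the norms themselves
    avoid a division by zero. *)
Lemma lp_add_bound N (r A B : R) (x y : 'I_N -> R) : 1 <= r -> 0 < A -> 0 < B ->
  (forall i, 0 <= x i) -> (forall i, 0 <= y i) ->
  lp r%:E x <= A -> lp r%:E y <= B -> lp r%:E (fun i => x i + y i) <= A + B.
Proof.
move=> r1 A0 B0 x0 y0 xA yB; have r0 : 0 < r by apply: lt_le_trans r1.
have AB0 : 0 < A + B by rewrite addr_gt0.
apply: lp_le_of_mean => //; [exact: ltW|by move=> i; rewrite addr_ge0|].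
pose t := A / (A + B).
have t01 : 0 <= t <= 1.
  by rewrite divr_ge0 ?(ltW A0) ?(ltW AB0)//= ler_pdivrMr// mul1r lerDl ltW.
have [t0 t1] : 0 <= t /\ 0 <= 1 - t by rewrite subr_ge0; apply/andP.
have tE : 1 - t = B / (A + B) by rewrite /t; field; rewrite gt_eqF.
have hx : N%:R^-1 * \sum_(i < N) (x i / A) `^ r <= 1.
  under eq_bigr do rewrite powRM ?invr_ge0 ?(ltW A0)//.
  rewrite -mulr_suml mulrA -lp_pow// -powRM ?invr_ge0 ?lp_ge0 ?(ltW A0)//.
  apply: powR_le1; first exact: ltW.
    by rewrite divr_ge0 ?lp_ge0// ltW.
  by rewrite ler_pdivrMr// mul1r.
have hy : N%:R^-1 * \sum_(i < N) (y i / B) `^ r <= 1.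
  under eq_bigr do rewrite powRM ?invr_ge0 ?(ltW B0)//.
  rewrite -mulr_suml mulrA -lp_pow// -powRM ?invr_ge0 ?lp_ge0 ?(ltW B0)//.
  apply: powR_le1; first exact: ltW.
    by rewrite divr_ge0 ?lp_ge0// ltW.
  by rewrite ler_pdivrMr// mul1r.
have -> : \sum_(i < N) (x i + y i) `^ r
    = (A + B) `^ r * \sum_(i < N) (t * (x i / A) + (1 - t) * (y i / B)) `^ r.
  rewrite mulr_sumr; apply: eq_bigr => i _; rewrite -powRM ?(ltW AB0)//.
    by congr (_ `^ r); rewrite tE /t; field; rewrite !gt_eqF.
  by rewrite addr_ge0// mulr_ge0// divr_ge0// ltW.
rewrite mulrCA ler_piMr ?powR_ge0//.
apply: (@le_trans _ _ (t * (N%:R^-1 * \sum_(i < N) (x i / A) `^ r)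
   + (1 - t) * (N%:R^-1 * \sum_(i < N) (y i / B) `^ r))).
  rewrite ![t * _]mulrCA ![(1 - t) * _]mulrCA -mulrDr; apply: ler_wpM2l.
    by rewrite invr_ge0.
  rewrite !mulr_sumr -big_split /=; apply: ler_sum => i _.
  by apply: powR_lin_conv => //; rewrite divr_ge0// ltW.
rewrite [leRHS](_ : 1 = t * 1 + (1 - t) * 1); last by rewrite !mulr1 addrC subrK.
by apply: lerD; apply: ler_wpM2l.
Qed.

Lemma lp_add N p (x y : 'I_N -> R) : (1 <= p)%E ->
  (forall i, 0 <= x i) -> (forall i, 0 <= y i) ->
  lp p (fun i => x i + y i) <= lp p x + lp p y.
Proof.
move=> /exponentP[[r -> r1]|->] x0 y0; last first.
  apply: lpy_le => [|i]; first by rewrite addr_ge0 ?lp_ge0.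
  by apply: lerD; apply: lpy_ub.
apply/ler_addgt0Pr => e e0.
have -> : lp r%:E x + lp r%:E y + e = (lp r%:E x + e / 2) + (lp r%:E y + e / 2).
  by rewrite addrACA -splitr.
have e20 : 0 < e / 2 by rewrite divr_gt0.
apply: lp_add_bound => //; first by rewrite ltr_wpDl// lp_ge0.
- by rewrite ltr_wpDl// lp_ge0.
- by rewrite lerDl ltW.
- by rewrite lerDl ltW.
Qed.

(** Jensen's inequality on A; the first factor accounts for the indices outside. *)
Lemma lp_ge_mean N q (A : {set 'I_N}) (x : 'I_N -> R) : (1 <= q)%E ->
  (0 < #|A|)%N -> (forall i, 0 <= x i) ->
  (#|A|%:R / N%:R) `^ inv_exp q * (#|A|%:R^-1 * \sum_(i in A) x i) <= lp q x.
Proof.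
move=> q1 A0 x0; have k0 : 0 < #|A|%:R :> R by rewrite ltr0n.
have N0 : 0 < N%:R :> R.
  by rewrite ltr0n (leq_trans A0)// (leq_trans (max_card _))// card_ord.
have m0 : 0 <= #|A|%:R^-1 * \sum_(i in A) x i.
  by rewrite mulr_ge0 ?invr_ge0 ?sumr_ge0.
case/exponentP: q1 => [[r -> r1]|->]; last first.
  rewrite inv_expy powRr0 mul1r mulrC ler_pdivrMr// mulr_natr -sumr_const.
  by apply: ler_sum => i _; apply: lpy_ub.
have r0 : 0 < r by apply: lt_le_trans r1.
rewrite inv_expE -[X in _ * X](@powRVK _ r)// -powRM ?powR_ge0 ?divr_ge0//.
apply: ler_powR2; first by rewrite invr_ge0 ltW.
  by rewrite mulr_ge0 ?divr_ge0 ?powR_ge0.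
apply: (@le_trans _ _ (#|A|%:R / N%:R * (#|A|%:R^-1 * \sum_(i in A) x i `^ r))).
  by apply: ler_wpM2l; [rewrite divr_ge0|apply: jensen_powR].
rewrite -mulrA (mulrCA _ N%:R^-1) mulVKf ?gt_eqF//.
rewrite ler_wpM2l ?invr_ge0// [leRHS](bigID (fun i => i \in A)) /= lerDl.
by rewrite sumr_ge0// => i _; apply: powR_ge0.
Qed.

Lemma lp_mono N p q (x : 'I_N -> R) : (0 < N)%N -> (1 <= q)%E -> (q <= p)%E ->
  (forall i, 0 <= x i) -> lp q x <= lp p x.
Proof.
move=> N0 q1 qp x0; have p1 := le_trans q1 qp.
have N0' : 0 < N%:R :> R by rewrite ltr0n.
case/exponentP: q1 qp => [[s -> s1]|->]; last first.
  by rewrite leye_eq => /eqP ->.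
have s0 : 0 < s by apply: lt_le_trans s1.
case/exponentP: p1 => [[r -> r1]|->] qp; last first.
  apply: lp_le_of_mean => //; first exact: lp_ge0.
  rewrite mulrC ler_pdivrMr// mulr_natr -[X in _ *+ X](card_ord N) -sumr_const.
  by apply: ler_sum => i _; apply: ler_powR2; [apply: ltW| |apply: lpy_ub].
rewrite lee_fin in qp; apply: lp_le_of_mean => //; first exact: lp_ge0.
have r0 : 0 < r by apply: lt_le_trans r1.
have := @jensen_powR R 'I_N [set: 'I_N] (fun i => x i `^ s) (r / s).
rewrite ler_pdivlMr// mul1r cardsT card_ord => /(_ qp N0) /(_ _)/wrap[].
  by move=> i; apply: powR_ge0.
under [X in _ <= _ * X -> _]eq_bigr do rewrite -powRrM mulrC divfK ?gt_eqF//.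
have eT (F : 'I_N -> R) : \sum_(i in [set: 'I_N]) F i = \sum_(i < N) F i.
  by apply: eq_bigl => i; rewrite inE.
rewrite !eT.
rewrite -(@lp_pow N r)// => h.
have m0 : 0 <= N%:R^-1 * \sum_(i < N) x i `^ s.
  by rewrite mulr_ge0 ?invr_ge0 ?(ltW N0')// sumr_ge0// => i _; apply: powR_ge0.
move: (N%:R^-1 * _) m0 (lp r%:E x) (lp_ge0 r%:E x) h => m m0 L L0 h.
have rs0 : 0 < r / s by rewrite divr_gt0.
have -> : L `^ s = (L `^ r) `^ (r / s)^-1.
  by rewrite -powRrM invf_div mulrC divfK// gt_eqF.
rewrite -[leLHS](powRVK rs0 m0); apply: ler_powR2 => //; last exact: powR_ge0.
by rewrite invr_ge0 ltW.
Qed.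

(** Interpolation between the p-norm and the supremum: below the level tau, a
    power x^q is at most tau^(q - p) x^p. *)
Lemma lp_interp N p q (tau : R) (x : 'I_N -> R) : (0 < N)%N ->
  (1 <= p)%E -> (p < q)%E -> 0 <= tau ->
  (forall i, 0 <= x i) -> (forall i, x i <= tau) -> lp p x <= 1 ->
  lp q x <= tau `^ (fine p * (inv_exp p - inv_exp q)).
Proof.
move=> N0 p1 pq t0 x0 xt xp; have q1 := le_trans p1 (ltW pq).
case/exponentP: p1 pq xp => [[r -> r1]|->]; last by rewrite ltNge leey.
have r0 : 0 < r by apply: lt_le_trans r1.
have N0' : 0 < N%:R :> R by rewrite ltr0n.
case/exponentP: q1 => [[s -> s1]|->] pq xp; rewrite inv_expE [fine _]/=; last first.
  by rewrite inv_expy subr0 mulfV ?gt_eqF// powRr1//; apply: lpy_le.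
rewrite lte_fin in pq; have s0 : 0 < s by apply: lt_trans pq.
apply: lp_le_of_mean => //; first exact: powR_ge0.
rewrite inv_expE -powRrM -mulrA mulrBl mulVf ?gt_eqF//.
have -> : r * (r^-1 * s - 1) = s - r by field; rewrite gt_eqF.
apply: (@le_trans _ _ (N%:R^-1 * \sum_(i < N) tau `^ (s - r) * x i `^ r)).
  rewrite ler_wpM2l ?invr_ge0 ?(ltW N0')//; apply: ler_sum => i _.
  have -> : s = (s - r) + r by ring.
  rewrite powRD; last by rewrite subrK gt_eqF.
  rewrite addrK; apply: ler_wpM2r; first exact: powR_ge0.
  by apply: ler_powR2 => //; rewrite subr_ge0 ltW.
rewrite -mulr_sumr mulrCA ler_piMr ?powR_ge0// -lp_pow//.
by apply: powR_le1 => //; [exact: ltW|exact: lp_ge0].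
Qed.

Lemma lp_eq0 N p (x : 'I_N -> R) : (0 < N)%N -> (1 <= p)%E ->
  (forall i, 0 <= x i) -> lp p x = 0 -> forall i, x i = 0.
Proof.
move=> N0 p1 x0 h i.
have := @lp_ge_mean N p [set i] x p1; rewrite cards1 => /(_ isT x0).
rewrite big_set1 h invr1 mul1r pmulr_rle0; last first.
  by rewrite powR_gt0// divr_gt0// ltr0n.
by move=> h1; apply/le_anti; rewrite h1 x0.
Qed.

(** For p < q this is interpolation, since no entry exceeds N^(1/p) times the
    p-norm. *)
Lemma lp_embed N p q (x : 'I_N -> R) : (0 < N)%N -> (1 <= p)%E -> (1 <= q)%E ->
  (forall i, 0 <= x i) ->
  lp q x <= N%:R `^ pos_part (inv_exp p - inv_exp q) * lp p x.
Proof.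
move=> N0 p1 q1 x0; have N0' : 0 < N%:R :> R by rewrite ltr0n.
rewrite /pos_part; case: (leP q p) => [qp|pq].
  rewrite max_r; last by rewrite subr_le0 inv_exp_le.
  by rewrite powRr0 mul1r lp_mono.
rewrite max_l; last by rewrite subr_ge0 inv_exp_le// ltW.
have [h|h] := eqVneq (lp p x) 0.
  have x00 := lp_eq0 N0 p1 x0 h.
  have -> : x = (fun i => 0 * x i) by apply/funext => i; rewrite x00 mulr0.
  by rewrite !lp_scale// !mul0r mulr0.
have c0 : 0 < lp p x by rewrite lt_neqAle eq_sym h lp_ge0.
set c := lp p x in c0 *.
have -> : lp q x = c * lp q (fun i => c^-1 * x i).
  by rewrite lp_scale ?invr_ge0 ?(ltW c0)// mulrA mulfV ?mul1r// gt_eqF.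
rewrite mulrC ler_pM2r//.
have y0 i : 0 <= c^-1 * x i by rewrite mulr_ge0// invr_ge0 ltW.
have yp : lp p (fun i => c^-1 * x i) <= 1.
  by rewrite lp_scale ?invr_ge0 ?(ltW c0)// mulVf// gt_eqF.
have yt i : c^-1 * x i <= N%:R `^ inv_exp p.
  have := @lp_ge_mean N p [set i] (fun i => c^-1 * x i) p1; rewrite cards1.
  move=> /(_ isT y0); rewrite big_set1 invr1 !mul1r powRV ?(ltW N0')// => /le_trans /(_ yp).
  by rewrite mulrC ler_pdivrMr ?powR_gt0// mul1r.
have := @lp_interp N p q _ _ N0 p1 pq (powR_ge0 _ _) y0 yt yp.
have [[r pr r1]|py] := exponentP p1; last by rewrite py ltNge leey in pq.
rewrite pr -powRrM inv_expE mulrA /= mulVf ?mul1r//.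
by rewrite gt_eqF// (lt_le_trans _ r1).
Qed.

End LpMean.

(** * Moduli and mixed norms *)

Section Modulus.
Context {R : realType} {k : base_field}.
Implicit Types x y : Defs.scalar R k.

Lemma modulus_ge0 x : 0 <= modulus x.
Proof. by case: k x => [x|[a b]] /=; [exact: normr_ge0|exact: sqrtr_ge0]. Qed.

Lemma modulus0 : modulus (0 : Defs.scalar R k) = 0.
Proof. by case: k => /=; [exact: normr0|exact: Normc.normc0]. Qed.

Lemma modulusN x : modulus (- x) = modulus x.
Proof. by case: k x => x /=; [exact: normrN|exact: normcN]. Qed.

Lemma modulusD x y : modulus (x + y) <= modulus x + modulus y.
Proof. by case: k x y => x y /=; [exact: ler_normD|exact: le_normcD]. Qed.

Lemma modulus_dbl x : modulus (x + x) = 2 * modulus x.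
Proof.
rewrite -mulr2n mulr_natl.
by case: k x => x /=; [exact: normrMn|exact: normcMn].
Qed.

Lemma modulus_onto (c : R) : 0 <= c -> {x : Defs.scalar R k | modulus x = c}.
Proof.
move=> c0; case: k => /=; first by exists c; rewrite ger0_norm.
by exists (Complex c 0) => /=; rewrite expr0n /= addr0 sqrtr_sqr ger0_norm.
Qed.

(** No output is close to both of two opposite values. *)
Lemma modulus_pm (c : R) x y : modulus x = c ->
  2 * c <= modulus (x - y) + modulus (- x - y).
Proof.
move=> <-; rewrite -modulus_dbl.
have -> : x + x = (x - y) - (- x - y) by rewrite opprB opprK addrA subrK.
by apply: le_trans (modulusD _ _) _; rewrite modulusN.
Qed.

End Modulus.

Section MixedNorm.
Context {R : realType} {k : base_field}.
Implicit Types (p q u v : \bar R).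

Lemma mixedE N1 N2 p u (f : 'M[Defs.scalar R k]_(N1, N2)) :
  mixed_norm p u f = lp p (fun i => lp u (fun j => modulus (f i j))).
Proof.
rewrite /mixed_norm lpnormE; congr lp; apply/funext => i.
by rewrite lpnormE [modulus _]ger0_norm// lp_ge0.
Qed.

Lemma mixed_ge0 N1 N2 p u (f : 'M[Defs.scalar R k]_(N1, N2)) :
  0 <= mixed_norm p u f.
Proof. by rewrite mixedE lp_ge0. Qed.

Lemma mixedN N1 N2 p u (f : 'M[Defs.scalar R k]_(N1, N2)) :
  mixed_norm p u (- f) = mixed_norm p u f.
Proof.
rewrite !mixedE; congr lp; apply/funext => i; congr lp; apply/funext => j.
by rewrite !mxE modulusN.
Qed.

Lemma mixedD N1 N2 p u (f g : 'M[Defs.scalar R k]_(N1, N2)) :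
  (1 <= p)%E -> (1 <= u)%E ->
  mixed_norm p u (f + g) <= mixed_norm p u f + mixed_norm p u g.
Proof.
move=> p1 u1; rewrite !mixedE.
apply: le_trans (@lp_add _ _ _ _ _ p1 _ _); last 2 first.
- by move=> i; apply: lp_ge0.
- by move=> i; apply: lp_ge0.
apply: lp_le => // i; first exact: lp_ge0.
apply: le_trans (@lp_add _ _ _ _ _ u1 _ _); last 2 first.
- by move=> j; apply: modulus_ge0.
- by move=> j; apply: modulus_ge0.
by apply: lp_le => // j; [apply: modulus_ge0|rewrite mxE modulusD].
Qed.

Lemma mixed0 N1 N2 p u : (1 <= p)%E -> (1 <= u)%E ->
  mixed_norm p u (0 : 'M[Defs.scalar R k]_(N1, N2)) = 0.
Proof.
move=> p1 u1; rewrite mixedE.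
have z0 N r : (1 <= r)%E -> lp r (fun _ : 'I_N => 0 : R) = 0.
  move=> r1; have := @lp_scale R N r 0 (fun _ => 0) r1 (lexx _).
  by rewrite !mul0r; apply.
rewrite (_ : (fun i => _) = fun=> 0); first exact: z0.
apply/funext => i; rewrite -(z0 N2 u u1); congr lp; apply/funext => j.
by rewrite mxE modulus0.
Qed.

Lemma mixed_embed N1 N2 p q u v (f : 'M[Defs.scalar R k]_(N1, N2)) :
  (0 < N1)%N -> (0 < N2)%N ->
  (1 <= p)%E -> (1 <= q)%E -> (1 <= u)%E -> (1 <= v)%E ->
  mixed_norm q v f <= N1%:R `^ pos_part (inv_exp p - inv_exp q)
    * N2%:R `^ pos_part (inv_exp u - inv_exp v) * mixed_norm p u f.
Proof.
move=> N10 N20 p1 q1 u1 v1; rewrite !mixedE.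
set B := N2%:R `^ _; have B0 : 0 <= B by apply: powR_ge0.
apply: (@le_trans _ _
    (lp q (fun i => B * lp u (fun j => modulus (f i j))))).
  apply: lp_le => // i; first exact: lp_ge0.
  by apply: lp_embed => // j; apply: modulus_ge0.
rewrite lp_scale//; last by move=> i; apply: lp_ge0.
rewrite mulrAC mulrC; apply: ler_wpM2r => //.
by apply: lp_embed => // i; apply: lp_ge0.
Qed.

Lemma lp_supp N p (A : {set 'I_N}) (c : R) (x : 'I_N -> R) : (0 < N)%N ->
  (1 <= p)%E -> 0 <= c -> (forall i, 0 <= x i) -> (forall i, x i <= c) ->
  (forall i, i \notin A -> x i = 0) ->
  lp p x <= (#|A|%:R / N%:R) `^ inv_exp p * c.
Proof.
move=> N0 /exponentP[[r -> r1]|->] c0 x0 xc xA; last first.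
  by rewrite inv_expy powRr0 mul1r; apply: lpy_le.
have r0 : 0 < r by apply: lt_le_trans r1.
have kN : 0 <= #|A|%:R / N%:R :> R by rewrite divr_ge0.
apply: lp_le_of_mean => //; first by rewrite mulr_ge0// powR_ge0.
rewrite powRM ?powR_ge0// inv_expE powRKV// mulrAC mulrC.
rewrite ler_wpM2r ?invr_ge0// mulr_natl -sumr_const.
rewrite (bigID (fun i => i \in A)) /= [X in _ + X]big1 ?addr0; last first.
  by move=> i /xA ->; rewrite powR0// gt_eqF.
by apply: ler_sum => i _; apply: ler_powR2 => //; apply: ltW.
Qed.

(** The supports of the fooling inputs: all lower bounds come from inputs of
    constant modulus on such rows set. *)
Definition pattern N1 N2 (rows cols : nat) (Act : {set 'I_N1 * 'I_N2}) :=
  exists A : {set 'I_N1}, [/\ #|A| = rows,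
    forall i, i \in A -> #|[set j | (i, j) \in Act]| = cols &
    forall x, x \in Act -> x.1 \in A].

(** The height of an input on a pattern can be as large as the inverse of the
    norm of the indicator function of the pattern. *)
Lemma pattern_ball N1 N2 p u rows cols Act (f : 'M[Defs.scalar R k]_(N1, N2)) :
  (0 < N1)%N -> (0 < N2)%N -> (0 < rows)%N -> (0 < cols)%N ->
  (1 <= p)%E -> (1 <= u)%E ->
  pattern rows cols Act ->
  (forall i j, modulus (f i j) <=
     (N1%:R / rows%:R) `^ inv_exp p * (N2%:R / cols%:R) `^ inv_exp u) ->
  (forall i j, (i, j) \notin Act -> f i j = 0) ->
  mixed_norm p u f <= 1.
Proof.
move=> N10 N20 rows0 cols0 p1 u1 [A [cA cAct ActA]] fc f0.
have N10' : 0 < N1%:R :> R by rewrite ltr0n.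
have N20' : 0 < N2%:R :> R by rewrite ltr0n.
have rows0' : 0 < rows%:R :> R by rewrite ltr0n.
have cols0' : 0 < cols%:R :> R by rewrite ltr0n.
have pinv (x y : R) e : 0 < x -> 0 < y -> (x / y) `^ e * (y / x) `^ e = 1.
  move=> x0 y0; rewrite -powRM ?divr_ge0 ?ltW// mulrA divfK ?gt_eqF// mulfV ?gt_eqF//.
  by rewrite powR1.
have rowb i : lp u (fun j => modulus (f i j)) <= (N1%:R / rows%:R) `^ inv_exp p.
  have [iA|iA] := boolP (i \in A); last first.
    rewrite (_ : (fun j => _) = fun j => 0 * 0).
      by rewrite lp_scale// mul0r powR_ge0.
    apply/funext => j; rewrite mul0r f0 ?modulus0//.
    by apply: contra iA => /ActA.
  have := @lp_supp N2 u [set j | (i, j) \in Act] _ _ N20 u1 _ _ (fc i).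
  move=> /(_ _)/wrap[]; first by rewrite mulr_ge0 ?powR_ge0.
  move=> /(_ _)/wrap[]; first by move=> j; apply: modulus_ge0.
  move=> /(_ _)/wrap[]; first by move=> j; rewrite inE => /f0 ->; rewrite modulus0.
  by rewrite cAct// mulrCA pinv// mulr1.
rewrite mixedE; have := @lp_supp N1 p A _ _ N10 p1 (powR_ge0 _ _) _ rowb.
move=> /(_ _)/wrap[]; first by move=> i; apply: lp_ge0.
move=> /(_ _)/wrap[]; last by rewrite cA pinv.
move=> i iA; rewrite (_ : (fun j => _) = fun j => 0 * 0).
  by rewrite lp_scale// mul0r.
apply/funext => j; rewrite mul0r f0 ?modulus0//.
by apply: contra iA => /ActA.
Qed.

(** Jensen's inequality in both variables: the norm controls the mean modulus over
    the pattern. *)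
Lemma pattern_mean N1 N2 q v rows cols Act (g : 'M[Defs.scalar R k]_(N1, N2)) :
  (0 < rows)%N -> (0 < cols)%N -> (1 <= q)%E -> (1 <= v)%E ->
  pattern rows cols Act ->
  (rows%:R / N1%:R) `^ inv_exp q * (cols%:R / N2%:R) `^ inv_exp v
    * ((rows * cols)%:R^-1 * \sum_(x in Act) modulus (g x.1 x.2)) <= mixed_norm q v g.
Proof.
move=> rows0 cols0 q1 v1 [A [cA cAct ActA]]; rewrite mixedE.
have := @lp_ge_mean R N1 q A (fun i => lp v (fun j => modulus (g i j))) q1.
rewrite cA => /(_ rows0 (fun i => lp_ge0 _ _)); apply: le_trans.
rewrite natrM invfM -!mulrA; apply: ler_wpM2l; first exact: powR_ge0.
rewrite mulrCA; apply: ler_wpM2l; first by rewrite invr_ge0.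
rewrite (_ : \sum_(x in Act) _ =
    \sum_(i in A) \sum_(j in [set j | (i, j) \in Act]) modulus (g i j)).
  rewrite !mulr_sumr; apply: ler_sum => i iA.
  have := @lp_ge_mean R N2 v [set j | (i, j) \in Act]
    (fun j => modulus (g i j)) v1.
  by rewrite cAct// => /(_ cols0 (fun j => modulus_ge0 _)).
rewrite pair_big_dep /=; apply: eq_bigl => -[i j] /=.
by rewrite inE; case: (boolP (_ \in Act)) => [/ActA /= ->|]; rewrite ?andbF.
Qed.

End MixedNorm.

(** * Fooling inputs *)

Lemma sum_option_bool (V : zmodType) (F : option bool -> V) :
  \sum_b F b = F None + F (Some true) + F (Some false).
Proof.
rewrite (bigD1 None) //= (bigD1 (Some true)) //= (bigD1 (Some false)) //=.
by rewrite big1 ?addr0 ?addrA// => -[[]|].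
Qed.

Section FoolingInputs.
Context {R : realType} {k : base_field} (N1 N2 : nat).
Local Notation K := (Defs.scalar R k).
Local Notation P := ('I_N1 * 'I_N2)%type.
Local Notation X := ('M[K]_(N1, N2)).
Variables (I T : finType) (reg : I -> T -> {set P}) (d : nat) (c : R) (e : K).
Hypothesis reg_inj : forall i t i' t' x,
  x \in reg i t -> x \in reg i' t' -> i = i' /\ t = t'.
Hypothesis reg_card : forall i t, #|reg i t| = d.
Hypothesis T_gt0 : (0 < #|T|)%N.
Hypothesis e_mod : modulus e = c.
Variables (Q : X -> {set P}) (out : X -> X).
Hypothesis Q_local : forall f g : X,
  (forall x, x \in Q f -> f x.1 x.2 = g x.1 x.2) -> Q g = Q f /\ out g = out f.

(** A component i sits in one of its cells, reg i t, and carries there the value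
    e, - e or 0. The value 0 makes the input independent of the cell, which is
    what allows the cost of a search to be charged to inputs of the family. *)
Definition state := {ffun I -> T * option bool}.

Definition sgn_val (s : option bool) : K :=
  if s is Some b then (if b then e else - e) else 0.

Definition fool (s : state) : X := \matrix_(a, b)
  \sum_(i | (a, b) \in reg i (s i).1) sgn_val (s i).2.

Definition active (s : state) : {set P} := \bigcup_i reg i (s i).1.

Definition upd (s : state) (i : I) (z : T * option bool) : state :=
  [ffun l => if l == i then z else s l].

Lemma sgn_val_mod s : modulus (sgn_val s) <= c.
Proof.
have c0 : 0 <= c by rewrite -e_mod modulus_ge0.
by case: s => [[]|] /=; rewrite ?modulusN ?e_mod// modulus0.
Qed.

Lemma foolE (s : state) i x : x \in reg i (s i).1 -> fool s x.1 x.2 = sgn_val (s i).2.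
Proof.
move=> xi; rewrite mxE -surjective_pairing (big_pred1 i)// => l /=.
apply/idP/eqP => [xl|-> //]; by have [] := reg_inj xl xi.
Qed.

Lemma fool_off (s : state) x : x \notin active s -> fool s x.1 x.2 = 0.
Proof.
move=> /bigcupP xs; rewrite mxE -surjective_pairing big1// => l xl.
by case: xs; exists l.
Qed.

Lemma fool_mod (s : state) x : modulus (fool s x.1 x.2) <= c.
Proof.
have [/bigcupP[i _ xi]|xs] := boolP (x \in active s).
  by rewrite (foolE xi) sgn_val_mod.
by rewrite fool_off// modulus0 -e_mod modulus_ge0.
Qed.

Lemma fool_upd (s : state) i t t' b x : x \notin reg i t ->
  fool (upd s i (t', None)) x.1 x.2 = fool (upd s i (t, b)) x.1 x.2.
Proof.
move=> xt; rewrite !mxE -surjective_pairing [LHS]big_mkcond [RHS]big_mkcond /=.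
apply: eq_bigr => l _; rewrite !ffunE; case: eqP => [->|//] /=.
by rewrite (negbTE xt) if_same.
Qed.

Lemma fool_upd0 (s : state) i t t' : fool (upd s i (t', None)) = fool (upd s i (t, None)).
Proof.
apply/matrixP => a b; rewrite !mxE [LHS]big_mkcond [RHS]big_mkcond /=.
apply: eq_bigr => l _; rewrite !ffunE; case: eqP => [->|//] /=.
by rewrite !if_same.
Qed.

Definition err_on (i : I) (s : state) : R :=
  \sum_(x in reg i (s i).1) modulus (fool s x.1 x.2 - out (fool s) x.1 x.2).

(** Cells are disjoint, so summed over i this counts no touched entry twice. *)
Definition touch (i : I) (f : X) : R := \sum_t #|Q f :&: reg i t|%:R.

Definition cost (i : I) (s : state) : R :=
  err_on i s + (2 * c * d%:R / #|T|%:R) * touch i (fool s).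

Lemma touch_ge0 i f : 0 <= touch i f.
Proof. by apply: sumr_ge0. Qed.

Lemma err_on_ge0 i (s : state) : 0 <= err_on i s.
Proof. by apply: sumr_ge0 => x _; apply: modulus_ge0. Qed.

(** If the input f0 with component i switched off leaves the cell reg i t
    untouched, then the inputs with values e and - e in that cell get the same
    output as f0. *)
Lemma err_pm i (s : state) t f0 : f0 = fool (upd s i (t, None)) ->
  2 * c * d%:R * (1 - #|Q f0 :&: reg i t|%:R)
  <= err_on i (upd s i (t, Some true)) + err_on i (upd s i (t, Some false)).
Proof.
move=> f0E; have c0 : 0 <= c by rewrite -e_mod modulus_ge0.
have cd0 : 0 <= 2 * c * d%:R by rewrite !mulr_ge0.
have [Qt|Qt] := posnP #|Q f0 :&: reg i t|; last first.
  apply: (@le_trans _ _ 0); last by rewrite addr_ge0 ?err_on_ge0.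
  by rewrite mulr_ge0_le0// subr_le0 ler1n.
rewrite Qt subr0 mulr1.
have same b : out (fool (upd s i (t, Some b))) = out f0.
  apply: (proj2 (Q_local _)) => x xQ; rewrite f0E; apply: fool_upd.
  apply/negP => xt; move/eqP: Qt; rewrite cards_eq0 => /eqP/setP/(_ x).
  by rewrite !inE xQ xt.
rewrite /err_on !ffunE !eqxx /= -big_split /= -(reg_card i t) mulr_natr.
rewrite -sumr_const; apply: ler_sum => x xt; rewrite !same.
have val b : fool (upd s i (t, b)) x.1 x.2 = sgn_val b.
  by rewrite (@foolE _ i) ffunE eqxx.
by rewrite !val; apply: modulus_pm.
Qed.

(** With all other components fixed, the touched cells of component i on the
    input with i switched off are the only cells in which the algorithm can
    succeed; their number is paid for by the second term of the cost. *)
Lemma cost_component i (s : state) : 2 * c * d%:R * #|T|%:R <= \sum_z cost i (upd s i z).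
Proof.
have c0 : 0 <= c by rewrite -e_mod modulus_ge0.
have cd0 : 0 <= 2 * c * d%:R by rewrite !mulr_ge0.
have /card_gt0P[t0 _] := T_gt0.
pose f0 := fool (upd s i (t0, None)); pose w := 2 * c * d%:R / #|T|%:R.
have w0 : 0 <= w by rewrite divr_ge0.
have part t : w * touch i f0 + 2 * c * d%:R * (1 - #|Q f0 :&: reg i t|%:R)
    <= \sum_b cost i (upd s i (t, b)).
  have f0t : f0 = fool (upd s i (t, None)) by apply: fool_upd0.
  rewrite sum_option_bool -addrA; apply: lerD.
    by rewrite /cost -f0t lerDr err_on_ge0.
  apply: le_trans (err_pm f0t) _.
  by apply: lerD; rewrite /cost lerDl mulr_ge0// touch_ge0.
have -> : \sum_z cost i (upd s i z) = \sum_t \sum_b cost i (upd s i (t, b)).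
  by rewrite pair_bigA /=; apply: eq_bigr => -[].
apply: le_trans (ler_sum _ (fun t _ => part t)).
have wT : w * #|T|%:R = 2 * c * d%:R by rewrite divfK// pnatr_eq0 -lt0n.
rewrite big_split /= sumr_const -[X in _ <= X + _]mulr_natr
  [X in _ <= X + _]mulrAC wT.
rewrite -mulr_sumr -mulrDr sumrB sumr_const -/(touch i f0).
by rewrite addrC subrK.
Qed.

(** Averaging over all states is the same as averaging after one component has
    been resampled: exchanging the old value of a component with the new one is
    an involution. *)
Lemma cost_total :
  2 * c * d%:R * #|I|%:R * #|{: state}|%:R <= 3 * \sum_s \sum_i cost i s.
Proof.
have T0 : 0 < #|T|%:R :> R by rewrite ltr0n.
rewrite exchange_big /= mulr_sumr.
rewrite (mulrAC _ #|I|%:R) [leLHS]mulr_natr -sumr_const; apply: ler_sum => i _.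
rewrite -(ler_pM2r T0).
pose z3 : finType := (T * option bool)%type.
have cz : #|z3|%:R = 3 * #|T|%:R :> R.
  by rewrite card_prod card_option card_bool natrM mulrC.
have swap : \sum_(s : state) \sum_z cost i (upd s i z)
    = #|z3|%:R * \sum_(s : state) cost i s.
  rewrite mulr_sumr.
  under [RHS]eq_bigr do rewrite mulr_natl -sumr_const.
  rewrite !pair_bigA /=.
  pose h (y : state * z3) := (upd y.1 i y.2, y.1 i).
  have hK : involutive h.
    move=> [s z]; rewrite /h /= ffunE eqxx; congr (_, _).
    by apply/ffunP => l; rewrite !ffunE; case: eqP => [->|].
  rewrite (reindex_inj (inv_inj hK)) /=; apply: eq_bigr => -[s z] _ /=.
  congr cost.
  by apply/ffunP => l; rewrite !ffunE; case: eqP => [->|]; rewrite ?eqxx.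
rewrite [leRHS]mulrAC -cz -swap mulrAC.
rewrite [leLHS]mulr_natr -sumr_const; apply: ler_sum => s _.
exact: cost_component.
Qed.

Lemma touch_total f : \sum_i touch i f <= #|Q f|%:R.
Proof.
rewrite /touch pair_bigA /= -natr_sum ler_nat.
have dis : forall y z : I * T, y != z ->
    [disjoint Q f :&: reg y.1 y.2 & Q f :&: reg z.1 z.2].
  move=> [i t] [i' t'] /eqP yz; rewrite -setI_eq0; apply/set0Pn => -[x].
  rewrite !inE /= => /andP[/andP[_ xt] /andP[_ xt']].
  by have [ii tt] := reg_inj xt xt'; apply: yz; rewrite ii tt.
rewrite (eq_bigr (fun y : I * T =>
    \sum_(x in Q f :&: reg y.1 y.2) 1)%N) => [|y _]; last by rewrite sum1_card.
rewrite -partition_disjoint_bigcup// sum1_card; apply: subset_leq_card.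
by apply/bigcupsP => y _; apply: subsetIl.
Qed.

Lemma err_active (s : state) : \sum_i err_on i s =
  \sum_(x in active s) modulus (fool s x.1 x.2 - out (fool s) x.1 x.2).
Proof.
symmetry; apply: partition_disjoint_bigcup => i i' ii'.
rewrite -setI_eq0; apply/set0Pn => -[x]; rewrite !inE => /andP[xi xi'].
by have [/eqP] := reg_inj xi xi'; rewrite (negbTE ii').
Qed.

(** The bounds for the components add up. Since the last sum is at most the number of
    touched entries (touch_total), a small error has to be paid for by a large
    cardinality. *)
Lemma fooling : 2 * c * d%:R * #|I|%:R * #|{: state}|%:R <=
  3 * \sum_s ((\sum_(x in active s)
      modulus (fool s x.1 x.2 - out (fool s) x.1 x.2))
    + 2 * c * d%:R / #|T|%:R * (\sum_i touch i (fool s))).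
Proof.
apply: le_trans cost_total _; rewrite ler_pM2l//; apply: ler_sum => s _.
by rewrite /cost big_split /= err_active -mulr_sumr.
Qed.

End FoolingInputs.

(** * What a deterministic algorithm sees *)

Section StopTime.
Context {R : realType} {X K : Type} {G : zmodType} {Lambda : set (X -> K)}.
Variable A : @det_algorithm X K G Lambda.

Definition alive (f : X) (m : nat) :=
  forall i, (i < m)%N -> ~~ terminate A (info A f i).

Lemma stop_time_Some f n : alive f n -> terminate A (info A f n) ->
  stop_time A f = Some n.
Proof.
rewrite /stop_time => al tn; case: pselect => [h|]; last by case; exists n.
congr Some; case: ex_minnP => m tm mn.
have := mn _ tn; rewrite leq_eqVlt => /orP[/eqP //|/al].
by rewrite tm.
Qed.

Lemma stop_timeP f : (exists2 n, stop_time A f = Some n &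
    alive f n /\ terminate A (info A f n)) \/
  (stop_time A f = None /\ forall m, alive f m).
Proof.
have [h|h] := pselect (exists n, terminate A (info A f n)).
  left; have [m tm mn] := ex_minnP h.
  have al : alive f m.
    by move=> i im; apply/negP => /mn; rewrite leqNgt im.
  by exists m => //; apply: stop_time_Some.
right; split; first by rewrite /stop_time; case: pselect.
by move=> m i _; apply/negP => ti; apply: h; exists i.
Qed.

Lemma card_ge0 f : (0 <= Defs.card A f :> \bar R)%E.
Proof.
by rewrite /Defs.card; case: stop_time => [n|]; rewrite ?leey// lee_fin ler0n.
Qed.

Lemma card_Some f n : stop_time A f = Some n -> Defs.card A f = n%:R%:E :> \bar R.
Proof. by rewrite /Defs.card => ->. Qed.

Lemma run_Some f n : stop_time A f = Some n -> run A f = output A (info A f n).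
Proof. by rewrite /run => ->. Qed.

End StopTime.

Section Touched.
Context {R : realType} {K : Type} {N1 N2 : nat} {G : zmodType}.
Local Notation X := ('M[K]_(N1, N2)).
Local Notation P := ('I_N1 * 'I_N2)%type.
Local Notation Lambda := (@point_evaluations K N1 N2).
Implicit Types (A : @det_algorithm X K G Lambda) (f g : X).

(** Chosen from the functional alone, so that equal functionals share it; this is
    what makes the touched set of a non-adaptive algorithm constant. *)
Definition evaluated_at (L : X -> K) : option P :=
  [pick x : P | `[< L = fun f : X => f x.1 x.2 >]].

Lemma evaluated_atP A i (y : i.-tuple K) :
  exists2 x, evaluated_at (query A y) = Some x &
    query A y = fun f : X => f x.1 x.2.
Proof.
have [a [b ab]] := query_adm A y.
rewrite /evaluated_at; case: pickP => [x /asboolP h|/(_ (a, b))].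
  by exists x.
by move/asboolP; rewrite ab.
Qed.

Definition touched A f : {set P} := [set x | `[< exists2 m,
  alive A f m.+1 & evaluated_at (query A (info A f m)) = Some x >]].

Lemma info_agree A f g m : alive A f m ->
  (forall x, x \in touched A f -> f x.1 x.2 = g x.1 x.2) ->
  info A g m = info A f m.
Proof.
move=> al fg; elim: m al => [//|m IH] al /=.
have al' : alive A f m by move=> i im; apply: al; apply: ltnW.
rewrite IH//; apply: val_inj => /=; congr rcons.
have [x xE ->] := evaluated_atP A (info A f m).
by rewrite fg// inE; apply/asboolP; exists m.
Qed.

Lemma alive_agree A f g m :
  (forall x, x \in touched A f -> f x.1 x.2 = g x.1 x.2) ->
  alive A f m <-> alive A g m.
Proof.
move=> fg; split=> [al i im|].
  rewrite (info_agree _ fg); first exact: al.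
  by move=> j ji; apply: al; apply: ltn_trans im.
elim: m => [//|m IH] al.
have alf : alive A f m by apply: IH => i im; apply: al; apply: ltnW.
move=> i; rewrite ltnS leq_eqVlt => /orP[/eqP ->|]; last exact: alf.
by rewrite -(info_agree alf fg); apply: al.
Qed.

(** As long as the answers agree, so do the next query and the decision to stop. *)
Lemma touched_local A f g :
  (forall x, x \in touched A f -> f x.1 x.2 = g x.1 x.2) ->
  touched A g = touched A f /\ run A g = run A f.
Proof.
move=> fg; have ag m := alive_agree m fg; split.
  apply/setP => x; rewrite !inE; apply/asboolP/asboolP => -[m al <-].
    by exists m; [apply/ag|rewrite (info_agree _ fg)// => i im;
      apply: (proj2 (ag _) al); apply: ltnW].
  by exists m; [apply/ag|rewrite (info_agree _ fg)// => i im;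
      apply: al; apply: ltnW].
have [[n fn [al tn]]|[fn al]] := stop_timeP A f.
  have gn : stop_time A g = Some n.
    by apply: stop_time_Some; [apply/ag|rewrite (info_agree al fg)].
  by rewrite (run_Some gn) (run_Some fn) (info_agree al fg).
have gn : stop_time A g = None.
  have [[n _ [_ tn]]|[]//] := stop_timeP A g.
  have /(_ n (ltnSn n)) := (proj1 (ag n.+1) (al n.+1)).
  by rewrite tn.
by rewrite /run fn gn.
Qed.

Lemma touched_card A f : (#|touched A f|%:R%:E <= Defs.card A f :> \bar R)%E.
Proof.
have [[n fn [al tn]]|[fn al]] := stop_timeP A f; last by rewrite /Defs.card fn leey.
rewrite (card_Some fn) lee_fin ler_nat.
pose h (m : 'I_n) := evaluated_at (query A (info A f m)).
apply: (@leq_trans #|[set h m | m : 'I_n]|); last first.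
  by apply: leq_trans (leq_imset_card _ _) _; rewrite card_ord.
have sinj : injective (@Some P) by move=> y z [].
rewrite -(card_imset (mem (touched A f)) sinj).
apply/subset_leq_card/fintype.subsetP => _ /imsetP[x xT ->].
move: xT; rewrite inE => /asboolP[m alm mx].
have mn : (m < n)%N.
  by rewrite ltnNge; apply/negP => nm; have := alm n nm; rewrite tn.
by apply/imsetP; exists (Ordinal mn).
Qed.

Lemma touched_non_adaptive A f g : non_adaptive A -> touched A f = touched A g.
Proof.
move=> [nq nt]; have al f' g' m : alive A f' m -> alive A g' m.
  by move=> h i im; rewrite (nt i _ (info A f' i)); apply: h.
apply/setP => x; rewrite !inE; apply/asboolP/asboolP => -[m alm <-]; exists m.
- exact: al alm.
- by rewrite (nq m _ (info A f m)).
- exact: al alm.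
- by rewrite (nq m _ (info A g m)).
Qed.

End Touched.

(** * Averaging over inputs and randomness *)

Section Averaging.
Context {R : realType} {k : base_field} {N1 N2 : nat}.
Local Notation K := (Defs.scalar R k).
Local Notation X := ('M[K]_(N1, N2)).
Local Notation Lambda := (@point_evaluations K N1 N2).
Variables (q v : \bar R) (q1 : (1 <= q)%E) (v1 : (1 <= v)%E).
Variables (F : set X) (n : nat) (A : @ran_algorithm R X K X Lambda).
Hypothesis A_class : ran_class (mixed_norm q v) F n A.

Definition deviation (f : X) (w : sample A) : R :=
  mixed_norm q v (f - run (realization w) f).

(** Measurability of an algorithm refers to the topology of the norm, so that of
    its error rests on the triangle inequality. *)
Lemma norm_open_ball (f : X) (c : R) :
  norm_open (mixed_norm q v) [set g | mixed_norm q v (f - g) < c].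
Proof.
move=> g /= gc; exists (c - mixed_norm q v (f - g)); first by rewrite subr_gt0.
move=> h; rewrite ltrBrDl => hc; apply: le_lt_trans hc.
have -> : f - h = (f - g) - (h - g) by rewrite opprB addrA subrK.
by apply: le_trans (mixedD _ _ q1 v1) _; rewrite mixedN.
Qed.

Lemma measurable_deviation f : F f ->
  measurable_fun [set: sample A] (fun w => (deviation f w)%:E).
Proof.
move=> Ff; apply/measurable_EFinP.
apply: (measurability (@RGenInftyO.G R)); first exact: RGenInftyO.measurableE.
move=> _ [_ [c ->] <-]; rewrite setTI.
have [_ _ mB _] := A_class Ff.
rewrite (_ : _ @^-1` _ = [set w | mixed_norm q v
    (f - run (realization w) f) < c])%classic; last first.
  by apply/seteqP; split => w /=; rewrite in_itv.
apply: (mB [set g | mixed_norm q v (f - g) < c]%classic).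
by apply: sub_sigma_algebra; apply: norm_open_ball.
Qed.

Lemma deviation_le_error f : F f ->
  (\int[law A]_w (deviation f w)%:E <= ran_error (mixed_norm q v) F idfun A)%E.
Proof. by move=> Ff; apply: ereal_sup_ubound; exists f. Qed.

(** Yao's principle: averaging over finitely many inputs and then over the
    randomness reduces a lower bound to one for each realization. *)
Lemma averaging (S T : finType) (f : S -> X) (g : T -> X) (b kap : R) :
  (0 < #|S|)%N -> (forall s, F (f s)) -> (forall t, F (g t)) ->
  0 <= b -> 0 <= kap ->
  (forall w, ((b * #|S|%:R)%:E <= \sum_s (deviation (f s) w)%:E +
     kap%:E * \sum_t Defs.card (realization w) (g t))%E) ->
  ((b - kap * #|T|%:R * n%:R / #|S|%:R)%:E
     <= ran_error (mixed_norm q v) F idfun A)%E.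
Proof.
move=> S0 Ff Fg b0 kap0 lb; have S0' : 0 < #|S|%:R :> R by rewrite ltr0n.
set err := ran_error _ _ _ _.
have md s := measurable_deviation (Ff s).
have mc t : measurable_fun [set: sample A]
    (fun w => Defs.card (realization w) (g t) : \bar R).
  by have [] := A_class (Fg t).
have d0 s (w : sample A) : (0 <= (deviation (f s) w)%:E)%E by rewrite lee_fin mixed_ge0.
have c0 t (w : sample A) : (0 <= Defs.card (realization w) (g t) :> \bar R)%E.
  exact: card_ge0.
have int : ((b * #|S|%:R)%:E <= \sum_(s : S) err + kap%:E * \sum_(t : T) n%:R%:E)%E.
  have -> : ((b * #|S|%:R)%:E = \int[law A]_w cst (b * #|S|%:R)%:E w)%E.
    rewrite integral_cst// -[LHS]mule1; congr (_ * _)%E.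
    exact: esym (probability_setT (law A)).
  have ms : measurable_fun [set: sample A] (fun w => \sum_s (deviation (f s) w)%:E)%E.
    by apply: emeasurable_sum.
  have mt : measurable_fun [set: sample A]
      (fun w => \sum_t (Defs.card (realization w) (g t) : \bar R))%E.
    by apply: emeasurable_sum.
  have mkt : measurable_fun [set: sample A]
      (fun w => kap%:E * \sum_t (Defs.card (realization w) (g t) : \bar R))%E.
    exact: measurable_funeM.
  apply: (@le_trans _ _ (\int[law A]_w (\sum_s (deviation (f s) w)%:E +
     kap%:E * \sum_t Defs.card (realization w) (g t)))%E).
    apply: ge0_le_integral => //; first by move=> w _; rewrite lee_fin mulr_ge0.
    by apply: emeasurable_funD.
  rewrite ge0_integralD//; last 2 first.
  - by move=> w _; apply: sume_ge0.
  - by move=> w _; rewrite mule_ge0// sume_ge0.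
  rewrite ge0_integralZl//; last by move=> w _; apply: sume_ge0.
  rewrite !ge0_integral_sum//; apply: leeD.
    by apply: lee_sum => s _; apply: deviation_le_error.
  apply: lee_wpmul2l; first by rewrite lee_fin.
  by apply: lee_sum => t _; have [] := A_class (Fg t).
have /card_gt0P[s0 _] := S0.
have err0 : (0 <= err)%E.
  by apply: le_trans (deviation_le_error (Ff s0)); apply: integral_ge0 => w _.
move: int; case: err err0 => [r r0| _ _|//]; last by rewrite leey.
rewrite !sumEFin -EFinM -EFinD !lee_fin !sumr_const => h.
rewrite lerBlDr -(ler_pM2r S0') mulrDl divfK ?gt_eqF//.
by rewrite -(mulr_natr r) -(mulr_natr n%:R) in h; rewrite mulrAC -mulrA.
Qed.

End Averaging.

(** * Lower bounds from patterns *)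

Section LowerBounds.
Context {R : realType} (k : base_field) (N1 N2 : nat).
Hypotheses (N10 : (0 < N1)%N) (N20 : (0 < N2)%N).
Local Notation P := ('I_N1 * 'I_N2)%type.
Local Notation X := ('M[Defs.scalar R k]_(N1, N2)).
Variables (p q u v : \bar R).
Hypotheses (p1 : (1 <= p)%E) (q1 : (1 <= q)%E) (u1 : (1 <= u)%E) (v1 : (1 <= v)%E).

(** The fooling inputs fill patterns of rows x cols entries with the height that
    the unit ball allows. As long as n is at most a sixth of the number of
    cells, touching entries saves at most half of the error. *)
Lemma e_ran_lower (n rows cols d : nat) (I T : finType) (reg : I -> T -> {set P}) :
  (forall i t i' t' x, x \in reg i t -> x \in reg i' t' -> i = i' /\ t = t') ->
  (forall i t, #|reg i t| = d) -> (0 < #|T|)%N -> (0 < rows)%N -> (0 < cols)%N ->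
  (#|I| * d = rows * cols)%N -> (forall s, pattern rows cols (active reg s)) ->
  (6 * n <= #|I| * #|T|)%N ->
  ((3^-1 * ((N1%:R / rows%:R) `^ (inv_exp p - inv_exp q) *
     (N2%:R / cols%:R) `^ (inv_exp u - inv_exp v)))%:E
   <= e_ran_J k p q u v n N1 N2)%E.
Proof.
move=> reg_inj reg_card T0 rows0 cols0 Id pat n6; apply: le_ereal_inf_tmp => _ [A hA <-].
have N1' : 0 < N1%:R :> R by rewrite ltr0n.
have N2' : 0 < N2%:R :> R by rewrite ltr0n.
have rows' : 0 < rows%:R :> R by rewrite ltr0n.
have cols' : 0 < cols%:R :> R by rewrite ltr0n.
have T' : 0 < #|T|%:R :> R by rewrite ltr0n.
pose c : R := (N1%:R / rows%:R) `^ inv_exp p * (N2%:R / cols%:R) `^ inv_exp u.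
have c0 : 0 <= c by rewrite mulr_ge0 ?powR_ge0.
have [e eE] := @modulus_onto R k c c0.
pose f := fool reg e.
have Ff s : unit_ball p u (f s).
  rewrite /unit_ball /=; apply: (pattern_ball N10 N20 rows0 cols0 p1 u1 (pat s)).
    by move=> i j; apply: (fool_mod reg_inj eE s (i, j)).
  by move=> i j; apply: (fool_off e (x := (i, j))).
pose ka : R := (rows%:R / N1%:R) `^ inv_exp q * (cols%:R / N2%:R) `^ inv_exp v
  / (rows * cols)%:R.
have ka0 : 0 <= ka by rewrite divr_ge0 ?mulr_ge0 ?powR_ge0.
pose St : finType := {: state I T}.
have St0 : (0 < #|St|)%N.
  have /card_gt0P[t0 _] := T0.
  by apply/card_gt0P; exists [ffun=> (t0, None)].
pose b : R := ka * (2 / 3 * c * d%:R * #|I|%:R).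
pose kap : R := ka * (2 * c * d%:R / #|T|%:R).
have b0 : 0 <= b by rewrite !mulr_ge0 ?divr_ge0.
have kap0 : 0 <= kap by rewrite mulr_ge0// divr_ge0// !mulr_ge0.
have lb (w : sample A) : ((b * #|St|%:R)%:E <= \sum_(s : St) (deviation q v (f s) w)%:E
    + kap%:E * \sum_(s : St) Defs.card (realization w) (f s))%E.
  set Al := realization w.
  have fl := fooling reg_inj reg_card T0 eE (@touched_local _ _ _ _ Al).
  have bnd : b * #|St|%:R <= \sum_(s : St) deviation q v (f s) w
      + kap * \sum_(s : St) #|touched Al (f s)|%:R.
    apply: (@le_trans _ _ (ka * \sum_(s : St) (\sum_(x in active reg s)
        modulus (fool reg e s x.1 x.2 - run Al (fool reg e s) x.1 x.2)
      + 2 * c * d%:R / #|T|%:R * (\sum_i touch reg (touched Al) i (fool reg e s))))).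
      rewrite /b -mulrA; apply: ler_wpM2l => //.
      rewrite -(@ler_pM2l _ 3)//; apply: le_trans fl.
      by rewrite le_eqVlt; apply/orP; left; apply/eqP; field.
    rewrite mulr_sumr mulr_sumr -big_split /=; apply: ler_sum => s _.
    rewrite mulrDr; apply: lerD; last first.
      rewrite mulrA -/kap; apply: ler_wpM2l => //.
      exact: touch_total.
    have := pattern_mean (f s - run Al (f s)) rows0 cols0 q1 v1 (pat s).
    rewrite mulrA -/ka; apply: le_trans; apply: ler_wpM2l => //.
    by apply: ler_sum => x _; rewrite !mxE.
  apply: (@le_trans _ _ (\sum_(s : St) deviation q v (f s) w
      + kap * \sum_(s : St) #|touched Al (f s)|%:R)%:E); first by rewrite lee_fin.
  rewrite EFinD sumEFin leeD2l// EFinM lee_wpmul2l ?lee_fin//.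
  by rewrite -sumEFin; apply: lee_sum => s _; apply: touched_card.
have := averaging q1 v1 hA St0 Ff Ff b0 kap0 lb; apply: le_trans.
rewrite lee_fin (mulrAC kap) mulfK; last first.
  by rewrite pnatr_eq0 -lt0n.
have hn : n%:R / #|T|%:R <= #|I|%:R / 6 :> R.
  by rewrite ler_pdivlMr// mulrAC ler_pdivrMr// -!natrM ler_nat mulnC.
apply: (@le_trans _ _ (ka * c * (2 * d%:R) * (#|I|%:R / 3 - #|I|%:R / 6))); last first.
  apply: (@le_trans _ _ (ka * c * (2 * d%:R) * (#|I|%:R / 3 - n%:R / #|T|%:R))).
    by apply: ler_wpM2l; [rewrite !mulr_ge0|rewrite lerB].
  rewrite le_eqVlt; apply/orP; left; apply/eqP; rewrite /b /kap.
  by field; rewrite gt_eqF.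
have -> : ka * c * (2 * d%:R) * (#|I|%:R / 3 - #|I|%:R / 6)
    = 3^-1 * (ka * (#|I| * d)%:R * c) by rewrite natrM; field.
have pat0 : (rows * cols)%:R != 0 :> R by rewrite pnatr_eq0 -lt0n muln_gt0 rows0.
rewrite Id /ka divfK//.
rewrite ler_wpM2l ?invr_ge0// /c mulrACA.
by rewrite ![(_ / N1%:R) `^ _ * _]mulrC ![(_ / N2%:R) `^ _ * _]mulrC !powR_divB.
Qed.

(** A non-adaptive algorithm must spread its entries over all rows in advance, so
    all signs of one random row cannot be learned. For each row the fooling
    lemma applies with single entries as components; the touched sets of
    different inputs coincide, hence the costs of the rows add up to one
    cardinality. *)
Lemma e_ran_non_lower (n : nat) : (6 * n <= N1 * N2)%N ->
  ((3^-1 * N1%:R `^ (inv_exp p - inv_exp q))%:E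
   <= e_ran_non_J k p q u v n N1 N2)%E.
Proof.
move=> n6; apply: le_ereal_inf_tmp => _ [A [hA nonA] <-].
have N1' : 0 < N1%:R :> R by rewrite ltr0n.
have N2' : 0 < N2%:R :> R by rewrite ltr0n.
pose reg (r : 'I_N1) (j : 'I_N2) (t : unit) : {set P} := [set (r, j)].
have reg_inj r j t j' t' x : x \in reg r j t -> x \in reg r j' t' ->
    j = j' /\ t = t'.
  by rewrite !inE => /eqP -> /eqP[->]; case: t t' => -[].
have reg_card r j t : #|reg r j t| = 1%N by rewrite cards1.
have T0 : (0 < #|{: unit}|)%N by rewrite card_unit.
pose c : R := (N1%:R / 1%:R) `^ inv_exp p * (N2%:R / N2%:R) `^ inv_exp u.
have c0 : 0 <= c by rewrite mulr_ge0 ?powR_ge0.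
have [e eE] := @modulus_onto R k c c0.
have pat r s : pattern 1 N2 (active (reg r) s).
  exists [set r]; split; first by rewrite cards1.
    move=> i; rewrite inE => /eqP ->; rewrite -[RHS]card_ord -cardsT.
    congr #|pred_of_set _|; apply/setP => j; rewrite !inE; apply/bigcupP.
    by exists j; rewrite ?inE.
  by move=> x /bigcupP[j _]; rewrite !inE => /eqP ->.
pose St : finType := {: state 'I_N2 unit}.
pose S : finType := ('I_N1 * St)%type.
have St0 : (0 < #|St|)%N by apply/card_gt0P; exists [ffun=> (tt, None)].
have S0 : (0 < #|S|)%N by rewrite card_prod card_ord muln_gt0 N10.
pose f (y : S) := fool (reg y.1) e y.2.
have Ff y : unit_ball p u (f y).
  rewrite /unit_ball /=.
  apply: (pattern_ball N10 N20 (ltn0Sn 0) N20 p1 u1 (pat y.1 y.2)).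
    by move=> i j; apply: (fool_mod (reg_inj y.1) eE y.2 (i, j)).
  by move=> i j; apply: (fool_off e (x := (i, j))).
have F0 (t : unit) : unit_ball p u (0 : X).
  by rewrite /unit_ball /= mixed0// ler01.
pose ka : R := (1%:R / N1%:R) `^ inv_exp q * (N2%:R / N2%:R) `^ inv_exp v
  / (1 * N2)%:R.
have ka0 : 0 <= ka by rewrite divr_ge0 ?mulr_ge0 ?powR_ge0.
pose b : R := ka * (2 / 3 * c * N2%:R).
pose kap : R := ka * (2 * c * #|St|%:R).
have b0 : 0 <= b by rewrite !mulr_ge0 ?divr_ge0.
have kap0 : 0 <= kap by rewrite !mulr_ge0.
have lb (w : sample A) : ((b * #|S|%:R)%:E <= \sum_(y : S) (deviation q v (f y) w)%:E
    + kap%:E * \sum_(t : unit) Defs.card (realization w) (0%R : X))%E.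
  set Al := realization w; pose Q := touched Al 0.
  have QE g : touched Al g = Q by apply: touched_non_adaptive; apply: nonA.
  have fl r := fooling (reg_inj r) (reg_card r) T0 eE (@touched_local _ _ _ _ Al).
  have dev r (s : St) : ka * (\sum_(x in active (reg r) s)
      modulus (f (r, s) x.1 x.2 - run Al (f (r, s)) x.1 x.2))
      <= deviation q v (f (r, s)) w.
    have := pattern_mean (f (r, s) - run Al (f (r, s))) (ltn0Sn 0) N20 q1 v1
      (pat r s).
    rewrite mulrA -/ka; apply: le_trans; apply: ler_wpM2l => //.
    by apply: ler_sum => x _; rewrite !mxE.
  (* The single entries of all rows together are disjoint cells. *)
  have tch : \sum_r \sum_j touch (reg r) (touched Al) j 0 <= #|Q|%:R :> R.
    pose rg (y : P) (t : unit) : {set P} := [set y].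
    have rg_inj i t i' t' x : x \in rg i t -> x \in rg i' t' -> i = i' /\ t = t'.
      by rewrite !inE => /eqP -> /eqP ->; case: t t' => -[].
    have := @touch_total R k _ _ _ _ _ rg_inj (touched Al) 0.
    by apply: le_trans; rewrite pair_bigA /=; apply: ler_sum => -[].
  have bnd : b * #|S|%:R <= \sum_(y : S) deviation q v (f y) w + kap * #|Q|%:R.
    apply: (@le_trans _ _ (\sum_r ka * \sum_(s : St) (\sum_(x in active (reg r) s)
        modulus (f (r, s) x.1 x.2 - run Al (f (r, s)) x.1 x.2)
      + 2 * c * (\sum_j touch (reg r) (touched Al) j 0)))).
      rewrite card_prod card_ord natrM mulrCA [leLHS]mulr_natl.
      rewrite -[X in _ *+ X <= _](card_ord N1) -sumr_const; apply: ler_sum => r _.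
      rewrite /b -[leLHS]mulrA; apply: ler_wpM2l => //.
      rewrite -(@ler_pM2l _ 3)//; apply: le_trans (le_trans (fl r) _); last first.
        rewrite ler_pM2l//; apply: ler_sum => s _; apply: lerD => //.
        rewrite card_unit divr1 mulr1; apply: ler_wpM2l; first by rewrite mulr_ge0.
        by rewrite le_eqVlt; apply/orP; left; apply/eqP; apply: eq_bigr => j _;
          rewrite /touch !QE.
      by rewrite card_ord le_eqVlt; apply/orP; left; apply/eqP; field.
    under eq_bigr do rewrite big_split /= sumr_const -[_ *+ #|_|]mulr_natr mulrDr.
    rewrite big_split /=; apply: lerD.
      rewrite (eq_bigr (fun r => \sum_(s : St) ka * \sum_(x in active (reg r) s)
        modulus (f (r, s) x.1 x.2 - run Al (f (r, s)) x.1 x.2))); last first.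
        by move=> r _; rewrite mulr_sumr.
      by rewrite pair_bigA /=; apply: ler_sum => -[r s] _; apply: dev.
    rewrite -mulr_sumr -mulr_suml -mulr_sumr (mulrAC (2 * c)) mulrA.
    exact: ler_wpM2l.
  apply: (@le_trans _ _ (\sum_(y : S) deviation q v (f y) w + kap * #|Q|%:R)%:E).
    by rewrite lee_fin.
  rewrite EFinD sumEFin leeD2l// EFinM lee_wpmul2l ?lee_fin//.
  by rewrite (bigD1 tt) //= big1 ?adde0; [apply: touched_card|case].
have := averaging q1 v1 hA S0 Ff F0 b0 kap0 lb; apply: le_trans.
rewrite lee_fin card_unit mulr1.
have hn : n%:R / N1%:R <= N2%:R / 6 :> R.
  by rewrite ler_pdivlMr// mulrAC ler_pdivrMr// -!natrM ler_nat mulnC (mulnC N2).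
have St' : 0 < #|St|%:R :> R by rewrite ltr0n.
apply: (@le_trans _ _ (ka * c * 2 * (N2%:R / 3 - N2%:R / 6))); last first.
  apply: (@le_trans _ _ (ka * c * 2 * (N2%:R / 3 - n%:R / N1%:R))).
    by apply: ler_wpM2l; [rewrite !mulr_ge0|rewrite lerB].
  rewrite card_prod card_ord natrM le_eqVlt; apply/orP; left; apply/eqP.
  by rewrite /b /kap; field; rewrite !gt_eqF.
have -> : ka * c * 2 * (N2%:R / 3 - N2%:R / 6) = 3^-1 * (ka * (1 * N2)%:R * c).
  by rewrite mul1n; field.
rewrite /ka divfK ?pnatr_eq0 ?mul1n -?lt0n//.
rewrite ler_wpM2l ?invr_ge0// /c divff ?gt_eqF// !powR1 !mulr1.
by rewrite mulrC powR_divB// divr1.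
Qed.

End LowerBounds.

(** * The lower bounds *)

Lemma rceil_nat (R : realType) (x : R) : 0 < x ->
  exists c : nat, [/\ (0 < c)%N, rceil x = c%:R, x <= c%:R & c%:R < x + 1].
Proof.
move=> x0; have c0 : (0 < Num.ceil x)%R by rewrite ceil_gt0.
have cE : rceil x = `|Num.ceil x|%:R.
  by rewrite /rceil -[in LHS](gtz0_abs c0) -pmulrn.
exists `|Num.ceil x|%N; rewrite -cE; split => //.
- by rewrite absz_gt0 gt_eqF.
- exact: ceil_ge.
- by rewrite -ltrBlDr; have := ceilB1_lt x; rewrite rmorphB.
Qed.

Section LowerInstances.
Context {R : realType} (k : base_field) (N1 N2 : nat).
Hypotheses (N10 : (0 < N1)%N) (N20 : (0 < N2)%N).
Local Notation P := ('I_N1 * 'I_N2)%type.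
Variables (p q u v : \bar R).
Hypotheses (p1 : (1 <= p)%E) (q1 : (1 <= q)%E) (u1 : (1 <= u)%E) (v1 : (1 <= v)%E).
Local Notation a := (inv_exp p - inv_exp q).
Local Notation b := (inv_exp u - inv_exp v).
Local Notation e_ran n := (e_ran_J k p q u v n N1 N2).

(** Components are the entries of m full rows: signs cannot be guessed. *)
Lemma lower_rows n m : (0 < m)%N -> (m <= N1)%N -> (6 * n <= m * N2)%N ->
  ((3^-1 * (N1%:R / m%:R) `^ a)%:E <= e_ran n)%E.
Proof.
move=> m0 mN n6.
pose reg (y : 'I_m * 'I_N2) (t : unit) : {set P} := [set (widen_ord mN y.1, y.2)].
have := @e_ran_lower R k N1 N2 N10 N20 p q u v p1 q1 u1 v1 n m N2 1 _ _ reg.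
rewrite divff ?pnatr_eq0 -?lt0n// powR1 mulr1; apply => //.
- move=> [i j] [] [i' j'] [] x; rewrite !inE /= => /eqP -> /eqP[ii ->].
  by split=> //; congr (_, _); apply: val_inj.
- by move=> y t; rewrite cards1.
- by rewrite card_unit.
- by rewrite card_prod !card_ord muln1.
- move=> s; exists [set widen_ord mN r | r : 'I_m]; split.
  + by rewrite card_imset ?card_ord// => i j /(congr1 val) /= /val_inj.
  + move=> _ /imsetP[r _ ->]; rewrite -[RHS]card_ord -cardsT.
    congr #|pred_of_set _|; apply/setP => j; rewrite !inE; apply/bigcupP.
    by exists (r, j); rewrite ?inE.
  + move=> x /bigcupP[y _]; rewrite inE => /eqP -> /=.
    by apply/imsetP; exists y.1.
- by rewrite card_prod !card_ord card_unit muln1.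
Qed.

(** Components are the rows, each with one nonzero entry hidden in it. *)
Lemma lower_points n : (6 * n <= N1 * N2)%N ->
  ((3^-1 * N2%:R `^ b)%:E <= e_ran n)%E.
Proof.
move=> n6; pose reg (i : 'I_N1) (j : 'I_N2) : {set P} := [set (i, j)].
have := @e_ran_lower R k N1 N2 N10 N20 p q u v p1 q1 u1 v1 n N1 1 1 _ _ reg.
rewrite divff ?pnatr_eq0 -?lt0n// powR1 mul1r divr1; apply => //.
- by move=> i j i' j' x; rewrite !inE /= => /eqP -> /eqP[-> ->].
- by move=> y t; rewrite cards1.
- by rewrite card_ord.
- by rewrite card_ord.
- move=> s; exists [set: 'I_N1]; split=> //; first by rewrite cardsT card_ord.
  move=> i _; rewrite (_ : [set j | _] = [set (s i).1]) ?cards1//.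
  apply/setP => j; rewrite !inE; apply/bigcupP/eqP => [[i' _]|->].
    by rewrite inE => /eqP[-> ->].
  by exists i; rewrite ?inE.
- by rewrite !card_ord.
Qed.

(** A single component: one of the N1 * m disjoint blocks has to be found. *)
Lemma lower_block n m d : (0 < m)%N -> (0 < d)%N -> (m * d <= N2)%N ->
  (6 * n <= N1 * m)%N ->
  ((3^-1 * (N1%:R `^ a * (N2%:R / d%:R) `^ b))%:E <= e_ran n)%E.
Proof.
move=> m0 d0 mdN n6.
have lt_pos (t : 'I_m) (e : 'I_d) : (t * d + e < N2)%N.
  apply: leq_trans mdN; apply: (@leq_trans (t * d + d)); first by rewrite ltn_add2l.
  by rewrite -mulSnr leq_mul2r ltn_ord orbT.
pose pos t e := Ordinal (lt_pos t e).
have pos_inj (t t' : 'I_m) (e e' : 'I_d) :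
    (t * d + e = t' * d + e')%N -> t = t' /\ e = e'.
  move=> h.
  have tE : t = t'.
    have := congr1 (divn^~ d) h.
    rewrite !divnMDl// !divn_small// !addn0 => /eqP; rewrite val_eqE.
    by move/eqP.
  by split=> //; move: h; rewrite -tE => /addnI /val_inj.
pose reg (o : unit) (y : 'I_N1 * 'I_m) : {set P} := [set (y.1, pos y.2 e) | e : 'I_d].
have cu : #|{: unit}| = 1%N by apply: card_unit.
have := @e_ran_lower R k N1 N2 N10 N20 p q u v p1 q1 u1 v1 n 1 d d _ _ reg.
rewrite divr1; apply => //.
- move=> [] [i t] [] [i' t'] x /imsetP[e _ ->] /imsetP[e' _] /= [-> h].
  by have [-> _] := pos_inj _ _ _ _ h.
- move=> [] [i t]; rewrite card_imset ?card_ord// => e e' [].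
  by move=> h; have [] := pos_inj _ _ _ _ h.
- by rewrite card_prod !card_ord muln_gt0 N10.
- by rewrite cu.
- move=> s; exists [set (s tt).1.1]; split; first by rewrite cards1.
  + move=> i; rewrite inE => /eqP ->.
    rewrite (_ : [set j | _] = [set pos (s tt).1.2 e | e : 'I_d]).
      rewrite card_imset ?card_ord// => e e' /(congr1 val) h.
      by have [] := pos_inj _ _ _ _ h.
    apply/setP => j; rewrite !inE; apply/bigcupP/imsetP => [[[] _]|[e _ ->]].
      by move=> /imsetP[e _ [->]]; exists e.
    by exists tt => //; apply/imsetP; exists e.
  + by move=> x /bigcupP[[] _ /imsetP[e _ ->]]; rewrite inE.
- by rewrite cu mul1n card_prod !card_ord.
Qed.

(** The embedding norm is attained by a full matrix, by one entry in each row or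
    by a single entry, according to the signs of a and b; each of these extremal
    inputs is hard to find. The remaining case p < q, v < u would need one full
    row, which an adaptive algorithm can look for. *)
Lemma lower_embedding n : (6 * n <= N1 * N2)%N -> (q <= p)%E \/ (u <= v)%E ->
  ((3^-1 * N1%:R `^ pos_part a * N2%:R `^ pos_part b)%:E <= e_ran n)%E.
Proof.
move=> n6 hpq; rewrite /pos_part.
have [uv|vu] := leP u v.
  rewrite (@max_l _ _ b) ?subr_ge0 ?inv_exp_le//.
  have [qp|pq] := leP q p.
    rewrite max_r ?subr_le0 ?inv_exp_le// powRr0 mulr1.
    exact: lower_points.
  rewrite max_l ?subr_ge0 ?inv_exp_le ?(ltW pq)// -mulrA.
  by have := @lower_block n N2 1 N20 isT; rewrite muln1 divr1; apply.
have qp : (q <= p)%E by case: hpq => //; rewrite leNgt vu.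
rewrite !max_r ?subr_le0 ?inv_exp_le ?(ltW vu)// !powRr0 !mulr1.
have := @lower_rows n N1 N10 (leqnn _) n6.
by rewrite divff ?pnatr_eq0 -?lt0n// powR1 mulr1.
Qed.

(** Against n entries one can hide a block in a row, short enough not to be hit by
    the n / N1 entries spent per row, or fill so many rows that the n / N2 rows
    that can be read do not matter. *)
Lemma lower_adaptive n : (0 < n)%N -> (6 * n <= N1 * N2)%N ->
  (p < q)%E -> (v < u)%E ->
  ((72^-1 * N1%:R `^ a * (rceil (n%:R / N1%:R) `^ b + rceil (n%:R / N2%:R) `^ (- a)))%:E
   <= e_ran n)%E.
Proof.
move=> n0 n6 pq vu.
have N1' : 0 < N1%:R :> R by rewrite ltr0n.
have N2' : 0 < N2%:R :> R by rewrite ltr0n.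
have n0' : 0 < n%:R :> R by rewrite ltr0n.
have /andP[a0 a1] : 0 <= a <= 1 by apply: inv_exp_sub_itv => //; apply: ltW.
have /andP[b1 b0] : -1 <= b <= 0.
  by rewrite -opprB lerN2 oppr_le0 andbC; apply: inv_exp_sub_itv => //; apply: ltW.
have [c1 [c10 -> nc1 _]] := rceil_nat (divr_gt0 n0' N1').
have [c2 [c20 -> nc2 _]] := rceil_nat (divr_gt0 n0' N2').
have hc1 : (n <= N1 * c1)%N by move: nc1; rewrite ler_pdivrMr// -natrM ler_nat mulnC.
have hc2 : (n <= c2 * N2)%N by move: nc2; rewrite ler_pdivrMr// -natrM ler_nat.
have c1' : 0 < c1%:R :> R by rewrite ltr0n.
have c2' : 0 < c2%:R :> R by rewrite ltr0n.
have e36 (x : R) : 36^-1 * (12 * x) = 3^-1 * x by field.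
(* Multiples of 6 keep n below a sixth of the cells; the caps at N2 and N1 are
   harmless because n is at most N1 * N2 / 6. *)
pose m := minn (6 * c1) N2; pose d := (N2 %/ m)%N.
have m0 : (0 < m)%N by rewrite leq_min muln_gt0 c10 N20.
have mN : (m <= N2)%N by rewrite geq_minr.
have d0 : (0 < d)%N by rewrite divn_gt0.
have L1 : ((36^-1 * (N1%:R `^ a * c1%:R `^ b))%:E <= e_ran n)%E.
  apply: le_trans (@lower_block n m d m0 d0 _ _); last 2 first.
  - by rewrite mulnC leq_trunc_div.
  - by rewrite /m /minn; case: ifP => // _; rewrite mulnCA leq_mul2l hc1 orbT.
  rewrite lee_fin mulrCA [leRHS]mulrCA; apply: ler_wpM2l; first exact: powR_ge0.
  rewrite -e36; apply: ler_wpM2l => //.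
  apply: ler_powR_scale; rewrite ?ler1n//; first by rewrite divr_gt0// ltr0n.
  rewrite ler_pdivrMr ?ltr0n//.
  apply: (@le_trans _ _ (2 * m * d)%:R).
    rewrite ler_nat -mulnA mul2n -addnn [leqLHS](divn_eq N2 m) -/d (mulnC d).
    by rewrite leq_add2l (leq_trans (ltnW (ltn_pmod _ m0)))// leq_pmulr.
  rewrite natrM ler_wpM2r// -natrM ler_nat (_ : 12 = 2 * 6)%N// -mulnA.
  by rewrite leq_mul2l geq_minl orbT.
pose m2 := minn (6 * c2) N1.
have m20 : (0 < m2)%N by rewrite leq_min muln_gt0 c20 N10.
have L2 : ((36^-1 * (N1%:R `^ a * c2%:R `^ (- a)))%:E <= e_ran n)%E.
  apply: le_trans (@lower_rows n m2 m20 _ _); last 2 first.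
  - by rewrite geq_minr.
  - by rewrite /m2 /minn; case: ifP => // _; rewrite -mulnA leq_mul2l hc2 orbT.
  rewrite lee_fin powRM ?invr_ge0// powRV// -powRN.
  rewrite mulrCA [leRHS]mulrCA; apply: ler_wpM2l; first exact: powR_ge0.
  rewrite -e36; apply: ler_wpM2l => //.
  apply: ler_powR_scale; rewrite ?ltr0n ?lerN2 ?oppr_le0 ?ler1n//.
  rewrite -natrM ler_nat; apply: leq_trans (geq_minl _ _) _.
  by rewrite leq_mul2r orbT.
set X := N1%:R `^ a * c1%:R `^ b in L1; set Y := N1%:R `^ a * c2%:R `^ (- a) in L2.
have -> : 72^-1 * N1%:R `^ a * (c1%:R `^ b + c2%:R `^ (- a)) = 72^-1 * (X + Y).
  by rewrite /X /Y -mulrDr mulrA.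
have [XY|YX] := leP X Y.
  apply: le_trans L2; rewrite lee_fin.
  have -> : 36^-1 * Y = 72^-1 * (Y + Y) :> R by field.
  by rewrite ler_pM2l// lerD2r.
apply: le_trans L1; rewrite lee_fin.
have -> : 36^-1 * X = 72^-1 * (X + X) :> R by field.
by rewrite ler_pM2l// lerD2l ltW.
Qed.

End LowerInstances.

(** * Finite randomization *)

Section UniformLaw.
Context (R : realType) (m : nat).

Lemma inv_succ_ge0 : 0 <= (m.+1%:R^-1 : R).
Proof. by rewrite invr_ge0. Qed.

(** The uniform law on the first m+1 natural numbers; every finite family of
    algorithms can be indexed by them, and on the discrete space of natural
    numbers all measurability conditions are void. *)
Definition unif_law : set nat -> \bar R :=
  mscale (NngNum inv_succ_ge0) (msum (fun i : nat => \d_i) m.+1).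

HB.instance Definition _ := Measure.on unif_law.

Lemma unif_law_setT : unif_law [set: nat] = 1%E.
Proof.
rewrite /unif_law /mscale /= /msum.
rewrite (eq_bigr (fun=> 1%E)) => [|i _]; last exact: diracT.
rewrite sumEFin sumr_const card_ord -EFinM; congr EFin.
by rewrite mulVf// pnatr_eq0.
Qed.

HB.instance Definition _ := Measure_isProbability.Build _ _ _ unif_law unif_law_setT.

Lemma integral_unif_law (f : nat -> \bar R) : (forall i, 0 <= f i)%E ->
  (\int[unif_law]_i f i = (m.+1%:R^-1)%:E * \sum_(i < m.+1) f i)%E.
Proof.
move=> f0; have mf : measurable_fun [set: nat] f by move=> ? ? ?.
rewrite ge0_integral_mscale// ge0_integral_measure_sum//; congr (_ * _)%E.
by apply: eq_bigr => i _; rewrite integral_dirac// diracT mul1e.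
Qed.

End UniformLaw.

Section FiniteRandomization.
Context {R : realType} {X K : Type} {G : zmodType} (normG : G -> R).
Context (F : set X) (S : X -> G) (Lambda : set (X -> K)).
Hypotheses (normG0 : normG 0 = 0) (normG_ge0 : forall g, 0 <= normG g).
Variables (W : finType) (A : W -> @det_algorithm X K G Lambda).
Hypothesis W0 : (0 < #|W|)%N.
Variable cost_of : W -> X -> nat.
Hypothesis stopA : forall w f, F f -> stop_time (A w) f = Some (cost_of w f).

(** For a finite family of algorithms, averages replace expectations and no
    measurability condition is left. *)
Lemma finite_randomization (n : nat) (E : R) :
  (forall f, F f -> (\sum_w cost_of w f <= n * #|W|)%N) ->
  (forall f, F f -> \sum_w normG (S f - run (A w) f) <= E * #|W|%:R) ->
  exists B : @ran_algorithm R X K G Lambda,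
    [/\ ran_class normG F n B, (ran_error normG F S B <= E%:E)%E &
        (forall w, non_adaptive (A w)) -> ran_non_class normG F n B].
Proof.
move=> hn hE; have /card_gt0P[w0 _] := W0.
have [m mE] : exists m, #|W| = m.+1 by case: #|W| W0 => // m _; exists m.
pose rz (i : nat) := A (nth w0 (enum W) i).
pose B := @RanAlgorithm R X K G Lambda _ nat (unif_law R m) rz.
have avg (h : W -> R) : (forall w, 0 <= h w) ->
    (\int[law B]_i (h (nth w0 (enum W) i))%:E = (#|W|%:R^-1 * \sum_w h w)%:E)%E.
  move=> h0; rewrite /= integral_unif_law => [|i]; last by rewrite lee_fin.
  rewrite sumEFin -EFinM -mE; congr (_ * _)%:E.
  by rewrite -[RHS]big_enum (big_nth w0) big_mkord -cardE mE.
have W0' : 0 < #|W|%:R :> R by rewrite ltr0n.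
have cls : ran_class normG F n B.
  move=> f Ff; split.
  - by move=> ? ? ?.
  - rewrite (_ : (fun w => _) = fun i : nat =>
        ((cost_of (nth w0 (enum W) i) f)%:R%:E)); last first.
      by apply/funext => i; rewrite (card_Some (stopA _ Ff)).
    rewrite (avg (fun w => (cost_of w f)%:R))// lee_fin mulrC ler_pdivrMr//.
    by rewrite -natrM -natr_sum ler_nat hn.
  - by move=> C _.
  - exists [set run (A w) f | w in [set: W]]%classic; last first.
      by apply: aeW => w; exists (nth w0 (enum W) w).
    exists [set run (A w) f | w in [set: W]]%classic; split => //.
      by apply/finite_set_countable/finite_image; apply: finite_finset.
    by move=> g Tg e e0; exists g => //; rewrite subrr normG0.
exists B; split=> //; last by move=> nonA; split=> // w; apply: nonA.
apply: ub_ereal_sup => _ [f Ff <-].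
rewrite (avg (fun w => normG (S f - run (A w) f)))// lee_fin.
by rewrite mulrC ler_pdivrMr// hE.
Qed.

End FiniteRandomization.

(** * Two-phase algorithms *)

Section TwoPhase.
Context {N1 N2 : nat} {R : realType} {k : base_field}.
Local Notation KK := (Defs.scalar R k).
Local Notation X := ('M[KK]_(N1, N2)).
Local Notation P := ('I_N1 * 'I_N2)%type.
Local Notation Lambda := (@point_evaluations KK N1 N2).
Variables (pt : P) (L : seq P) (choose : (P -> KK) -> seq P).
Hypothesis choose_local : forall g g' : P -> KK,
  {in L, g =1 g'} -> choose g = choose g'.

Definition entry (f : X) (x : P) : KK := f x.1 x.2.

(** The first size L answers y, read as a function of the position; outside L the
    value is a default that the choice does not depend on. *)
Definition table (y : seq KK) (x : P) : KK := nth 0 y (index x L).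

Definition second (y : seq KK) : seq P := choose (table (take (size L) y)).

Definition next (y : seq KK) : P :=
  if (size y < size L)%N then nth pt L (size y)
  else nth pt (second y) (size y - size L).

Definition fill (y : seq KK) : X := \matrix_(a, b)
  if (a, b) \in second y
  then nth 0 (drop (size L) y) (index (a, b) (second y)) else 0.

Lemma entry_adm x : Lambda (entry^~ x).
Proof. by exists x.1, x.2. Qed.

(** Queries the positions in L, then the positions chosen from the answers, and
    outputs the chosen entries, with 0 elsewhere. The answers on L are discarded
    unless they are chosen as well. *)
Definition two_phase : @det_algorithm X KK X Lambda :=
  DetAlgorithm (fun i (y : i.-tuple KK) => entry_adm (next y))
    (fun i (y : i.-tuple KK) =>
      (size L <= i)%N && (i == size L + size (second y))%N)
    (fun i (y : i.-tuple KK) => fill y).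

Variable f : X.
Let trace : seq P := L ++ choose (entry f).

Lemma second_trace m : (size L <= m)%N ->
  second (map (entry f) (take m trace)) = choose (entry f).
Proof.
move=> Lm; rewrite /second -map_take take_takel// take_size_cat//.
apply: choose_local => x xL; rewrite /table (nth_map pt) ?index_mem//.
by rewrite nth_index.
Qed.

Lemma info_two_phase m : (m <= size trace)%N ->
  info two_phase f m = map (entry f) (take m trace) :> seq KK.
Proof.
elim: m => [|m IH] mt /=; first by rewrite take0.
rewrite IH ?(ltnW mt)// (take_nth pt mt) map_rcons; congr (rcons _ (entry _ _)).
rewrite /next size_map size_takel ?(ltnW mt)// nth_cat.
by case: ltnP => // Lm; rewrite second_trace.
Qed.

Lemma stop_two_phase :
  stop_time two_phase f = Some (size L + size (choose (entry f)))%N.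
Proof.
rewrite -size_cat -/trace; apply: stop_time_Some => [m mt|] /=; last first.
  rewrite info_two_phase// second_trace; last by rewrite size_cat leq_addr.
  by rewrite size_cat leq_addr eqxx.
rewrite negb_and; case: leqP => //= Lm.
by rewrite info_two_phase ?(ltnW mt)// second_trace// -size_cat neq_ltn mt.
Qed.

Lemma run_two_phase : run two_phase f =
  \matrix_(a, b) if (a, b) \in choose (entry f) then f a b else 0.
Proof.
rewrite (run_Some stop_two_phase) /= -size_cat -/trace.
apply/matrixP => a b; rewrite !mxE info_two_phase//.
rewrite second_trace; last by rewrite size_cat leq_addr.
case: ifP => // ab; rewrite take_size -map_drop drop_size_cat//.
by rewrite (nth_map pt) ?index_mem// nth_index.
Qed.

End TwoPhase.

(** * Estimating a norm from samples *)

Section Sampling.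
Context {R : realType} (N s : nat).
Hypothesis N0 : (0 < N)%N.
Local Notation sample_pts := {ffun 'I_s -> 'I_N}.
Implicit Types (x y : 'I_N -> R).

Let N0' : 0 < N%:R :> R. Proof. by rewrite ltr0n. Qed.

Lemma card_samples : #|{: sample_pts}|%:R = N%:R ^+ s :> R.
Proof. by rewrite card_ffun !card_ord natrX. Qed.

(** The chord of the convex function 2^(- y) over the unit interval. *)
Lemma powR_half (y : R) : 0 <= y -> y <= 1 -> 2 `^ (- y) <= 1 - y / 2.
Proof.
move=> y0 y1; have [->|yn0] := eqVneq y 0.
  by rewrite oppr0 powRr0 mul0r subr0.
have yp : 0 < y by rewrite lt_neqAle eq_sym yn0.
have h0 : 0 <= 2 `^ (- y) :> R by apply: powR_ge0.
have := @bernoulli_powR R y^-1 (2 `^ (- y)) _ h0.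
rewrite invf_ge1// => /(_ y1); rewrite -powRrM mulNr mulfV// powR_inv1//.
move=> h; have : y * (y^-1 * 2 `^ (- y)) <= y * (2^-1 + (y^-1 - 1)).
  by apply: ler_wpM2l.
rewrite mulVKf// mulrDr mulrBr mulfV// mulr1; lra.
Qed.

Lemma one_sub_le_powR (z : R) : 0 <= z -> 1 - z <= 2 `^ (- z).
Proof.
move=> z0; apply: (@le_trans _ _ (expR (- z))); first exact: expR_ge1Dx.
rewrite expRN powRN lef_pV2 ?posrE ?expR_gt0 ?powR_gt0//.
rewrite -[z in expR z]mul1r expRM; apply: ler_powR2 => //.
by have := @expR_ge1Dx R 1; rewrite -natr1.
Qed.

(** The exponential moment of a sum of independent samples is a product; the chord
    bounds the mean of each factor by 2^(- m / 2). *)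
Lemma chernoff (y : 'I_N -> R) (m : R) :
  (forall j, 0 <= y j) -> (forall j, y j <= 1) ->
  m = N%:R^-1 * \sum_j y j ->
  #|[set w : sample_pts | \sum_t y (w t) <= s%:R * m / 4]|%:R
    <= N%:R ^+ s * 2 `^ (- (s%:R * m / 4)).
Proof.
move=> y0 y1 mE; have m0 : 0 <= m by rewrite mE mulr_ge0 ?invr_ge0 ?sumr_ge0.
set c := s%:R * m / 4.
have pow_sum (r : seq 'I_s) (g : 'I_s -> R) :
    2 `^ (- \sum_(t <- r) g t) = \prod_(t <- r) 2 `^ (- g t) :> R.
  elim: r => [|t r IH]; first by rewrite !big_nil oppr0 powRr0.
  rewrite !big_cons opprD powRD ?IH//.
  by apply/implyP.
apply: (@le_trans _ _ (\sum_(w : sample_pts) 2 `^ (c - \sum_t y (w t)))).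
  rewrite -sum1_card natr_sum big_mkcond /=; apply: ler_sum => w _.
  rewrite inE; case: ifP => [h|_]; last exact: powR_ge0.
  rewrite -[leLHS](powRr0 2); apply: ler_powR; first by rewrite ler1n.
  by rewrite subr_ge0.
have -> : \sum_(w : sample_pts) 2 `^ (c - \sum_t y (w t))
    = 2 `^ c * (\sum_j 2 `^ (- y j)) ^+ s :> R.
  rewrite -[s in RHS]card_ord -prodr_const bigA_distr_bigA mulr_sumr /=.
  apply: eq_bigr => w _; rewrite powRD; last by apply/implyP.
  by rewrite pow_sum.
have hsum : \sum_j 2 `^ (- y j) <= N%:R * 2 `^ (- (m / 2)) :> R.
  apply: (@le_trans _ _ (\sum_j (1 - y j / 2))).
    by apply: ler_sum => j _; apply: powR_half.
  rewrite sumrB sumr_const card_ord -mulr_suml.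
  have -> : \sum_j y j = N%:R * m by rewrite mE mulVKf// gt_eqF.
  rewrite -mulrA -{1}[N%:R]mulr1 -mulrBr; apply: ler_wpM2l => //.
  by apply: one_sub_le_powR; rewrite divr_ge0.
apply: (@le_trans _ _ (2 `^ c * (N%:R * 2 `^ (- (m / 2))) ^+ s)).
  apply: ler_wpM2l; first exact: powR_ge0.
  by apply: lerXn2r => //; rewrite nnegrE ?mulr_ge0 ?powR_ge0// sumr_ge0// => j _;
    exact: powR_ge0.
rewrite exprMn mulrCA; apply: ler_wpM2l; first by rewrite exprn_ge0.
rewrite -powR_mulrn ?powR_ge0// -powRrM -powRD; last by apply/implyP.
by rewrite le_eqVlt; apply/orP; left; apply/eqP; congr (_ `^ _); rewrite /c; field.
Qed.

(** Samples of a function whose mean is dominated by moderate values rarely miss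
    it. The spikes above the level t contribute at most half of the mean, by the
    gap between the exponents; below t the tail bound applies. *)
Lemma sampling_misses_rarely (r : R) (u : \bar R) (x : 'I_N -> R) (th X : R) :
  1 <= r -> (r%:E < u)%E -> (0 < s)%N -> 0 < X -> 0 <= th ->
  (forall j, 0 <= x j) -> 0 < lp r%:E x -> 8 * th <= lp r%:E x ->
  2 * lp u x * (s%:R / (8 * X)) `^ (inv_exp u - r^-1) <= lp r%:E x ->
  #|[set w : sample_pts | s%:R^-1 * \sum_t x (w t) `^ r <= th `^ r]|%:R
    <= N%:R ^+ s * 2 `^ (- X).
Proof.
move=> r1 ru s0 X0 th0 x0; set a := lp r%:E x => a0 ath hb.
have r0 : 0 < r by apply: lt_le_trans r1.
have s0' : 0 < s%:R :> R by rewrite ltr0n.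
have [S SE] : {S : R | S = s%:R / (8 * X)} by eexists.
rewrite -SE in hb; have S0 : 0 < S by rewrite SE divr_gt0// mulr_gt0.
pose t := a * S `^ r^-1.
have t0 : 0 < t by rewrite mulr_gt0// powR_gt0.
have tr : t `^ r = a `^ r * S by rewrite powRM ?powR_ge0 ?ltW// powRKV// ltW.
have tr0 : 0 < t `^ r by rewrite powR_gt0.
have ar : a `^ r = N%:R^-1 * \sum_j x j `^ r by rewrite lp_pow.
pose big j := if x j <= t then 0 else x j `^ r.
(* t is the level at which the tail bound yields exactly the exponent X. *)
have spikes : N%:R^-1 * \sum_j big j <= a `^ r / 2.
  have [[rho uE rho1]|uE] : (exists2 rho, u = rho%:E & r < rho) \/ u = +oo%E.
    by case: u ru hb => // [rho|]; [rewrite lte_fin; left; exists rho|right].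
  - rewrite uE in hb; have rho0 : 0 < rho by apply: lt_trans rho1.
    have rho1' : 1 <= rho by apply: le_trans r1 (ltW rho1).
    set b := lp rho%:E x in hb; have b0 : 0 <= b by apply: lp_ge0.
    have brho : b `^ rho = N%:R^-1 * \sum_j x j `^ rho by rewrite lp_pow.
    apply: (@le_trans _ _ (t `^ (r - rho) * b `^ rho)).
      rewrite brho mulrCA; apply: ler_wpM2l; first by rewrite invr_ge0 ltW.
      rewrite mulr_sumr; apply: ler_sum => j _; rewrite /big.
      have [_|tx] /= := leP (x j) t; first by rewrite mulr_ge0 ?powR_ge0.
      have xj : 0 < x j by apply: lt_trans tx.
      have -> : x j `^ r = x j `^ (r - rho) * x j `^ rho.
        by rewrite -powRD ?subrK// (gt_eqF xj) implybT.
      apply: ler_wpM2r; first exact: powR_ge0.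
      by apply: ler_npowR => //; [rewrite subr_le0|]; apply: ltW.
    pose e := r^-1 - rho^-1.
    have bb : b <= a * 2^-1 * S `^ e.
      move: hb; rewrite inv_expE -[rho^-1 - _]opprB powRN -/e.
      by rewrite ler_pdivrMr ?powR_gt0// mulrAC ler_pdivlMr// mulrC.
    apply: (@le_trans _ _ (t `^ (r - rho) * (a * 2^-1 * S `^ e) `^ rho)).
      apply: ler_wpM2l; first exact: powR_ge0.
      by apply: ler_powR2 => //; apply: ltW.
    have -> : t `^ (r - rho) = a `^ (r - rho) * S `^ (r^-1 * (r - rho)).
      by rewrite powRM ?powR_ge0 ?(ltW a0)// -powRrM.
    have -> : (a * 2^-1 * S `^ e) `^ rho
        = a `^ rho * 2^-1 `^ rho * S `^ (e * rho).
      by rewrite powRrM -!powRM ?powR_ge0 ?mulr_ge0 ?(ltW a0).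
    rewrite mulrACA (mulrA (a `^ (r - rho))) -(@powRD R a); last first.
      by rewrite (gt_eqF a0) implybT.
    rewrite subrK -mulrA -(@powRD R S); last by rewrite (gt_eqF S0) implybT.
    have -> : r^-1 * (r - rho) + e * rho = 0.
      by rewrite /e; field; rewrite !gt_eqF.
    rewrite powRr0 mulr1; apply: ler_wpM2l; first exact: powR_ge0.
    apply: ge1r_powR => //.
    by rewrite invr_gt0 ltr0n/= invf_le1// ler1n.
  - rewrite (_ : \sum_j big j = 0) ?mulr0 ?divr_ge0 ?powR_ge0//.
    apply: big1 => j _; rewrite /big ifT//.
    rewrite uE inv_expy sub0r powRN ler_pdivrMr ?powR_gt0// in hb.
    apply: le_trans hb; apply: le_trans (lpy_ub x j) _.
    by rewrite ler_peMl ?lp_ge0// ler1n.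
pose y j := if x j <= t then x j `^ r / t `^ r else 0.
have y0 j : 0 <= y j by rewrite /y; case: ifP => // _; rewrite divr_ge0 ?powR_ge0.
have y1 j : y j <= 1.
  rewrite /y; case: ifP => // xt; rewrite ler_pdivrMr// mul1r.
  by apply: ler_powR2 => //; apply: ltW.
have yle j : y j <= x j `^ r / t `^ r.
  by rewrite /y; case: ifP => // _; rewrite divr_ge0 ?powR_ge0.
pose m := N%:R^-1 * \sum_j y j.
have SX : s%:R / (8 * S) = X by rewrite SE; field; rewrite !gt_eqF.
have atr : a `^ r / t `^ r = S^-1.
  by rewrite tr; field; rewrite !gt_eqF// powR_gt0.
have mX : X <= s%:R * m / 4.
  have mS : (2 * S)^-1 <= m.
    have -> : m = (N%:R^-1 * \sum_j x j `^ r - N%:R^-1 * \sum_j big j) / t `^ r.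
      rewrite -mulrBr -sumrB -mulrA; congr (_ * _); rewrite mulr_suml.
      apply: eq_bigr => j _; rewrite /y /big; case: ifP => _; first by rewrite subr0.
      by rewrite subrr mul0r.
    rewrite -ar ler_pdivlMr//; apply: (@le_trans _ _ (a `^ r / 2)); last by lra.
    by rewrite tr le_eqVlt; apply/orP; left; apply/eqP; field; rewrite gt_eqF.
  rewrite -SX ler_pdivlMr//; apply: le_trans (ler_wpM2l (ltW s0') mS).
  by rewrite le_eqVlt; apply/orP; left; apply/eqP; field; rewrite gt_eqF.
apply: (@le_trans _ _ #|[set w : sample_pts | \sum_t1 y (w t1) <= s%:R * m / 4]|%:R).
  rewrite ler_nat; apply/subset_leq_card/fintype.subsetP => w; rewrite !inE.
  rewrite mulrC ler_pdivrMr// => hw; apply: le_trans mX.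
  apply: (@le_trans _ _ (\sum_t1 x (w t1) `^ r / t `^ r)).
    by apply: ler_sum => t1 _; apply: yle.
  rewrite -mulr_suml ler_pdivrMr//; apply: le_trans hw _.
  have -> : X * t `^ r = a `^ r / 8 * s%:R.
    by rewrite tr -SX; field; rewrite !gt_eqF.
  apply: ler_wpM2r; first exact: ltW.
  apply: (@le_trans _ _ ((a / 8) `^ r)).
    by apply: ler_powR2 => //; [apply: ltW|rewrite ler_pdivlMr// mulrC].
  rewrite powRM ?invr_ge0 ?(ltW a0)//; apply: ler_wpM2l; first exact: powR_ge0.
  by apply: ge1r_powR => //; rewrite invr_gt0 ltr0n/= invf_le1// ler1n.
apply: le_trans (chernoff y0 y1 erefl) _; apply: ler_wpM2l; first exact: exprn_ge0.
by apply: ler_powR; rewrite ?ler1n// lerN2.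
Qed.

(** Markov's inequality: the expectation of the sample mean of x^r is the mean. *)
Lemma sampling_exceeds_rarely (r : R) (x : 'I_N -> R) (th : R) :
  1 <= r -> (0 < s)%N -> 0 < th -> (forall j, 0 <= x j) ->
  #|[set w : sample_pts | th `^ r < s%:R^-1 * \sum_t x (w t) `^ r]|%:R
    <= N%:R ^+ s * (lp r%:E x / th) `^ r.
Proof.
move=> r1 s0 th0 x0; have r0 : 0 < r by apply: lt_le_trans r1.
have s0' : 0 < s%:R :> R by rewrite ltr0n.
have thr : 0 < th `^ r by rewrite powR_gt0.
have mean : \sum_(w : sample_pts) s%:R^-1 * \sum_t x (w t) `^ r
    = N%:R ^+ s * lp r%:E x `^ r.
  rewrite lp_pow// -mulr_sumr exchange_big /=.
  have one t : \sum_(w : sample_pts) x (w t) `^ r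
      = N%:R ^+ s.-1 * \sum_j x j `^ r.
    pose F (t' : 'I_s) (j : 'I_N) := if t' == t then x j `^ r else 1.
    have -> : \sum_(w : sample_pts) x (w t) `^ r
        = \sum_(w : sample_pts) \prod_t' F t' (w t').
      apply: eq_bigr => w _; rewrite (bigD1 t) //= {1}/F eqxx big1 ?mulr1// => t' tt.
      by rewrite /F (negbTE tt).
    rewrite -bigA_distr_bigA (bigD1 t) //= mulrC; congr (_ * _); last first.
      by apply: eq_bigr => j _; rewrite /F eqxx.
    rewrite (eq_bigr (fun=> N%:R)) => [|t' tt]; last first.
      rewrite /F (negbTE tt) sumr_const card_ord//.
    by rewrite prodr_const cardC1 card_ord.
  rewrite (eq_bigr _ (fun t _ => one t)) sumr_const card_ord -[X in _^-1 * X]mulr_natl.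
  by rewrite mulKf ?gt_eqF// mulrA -[in RHS](prednK s0) exprSr mulfK// gt_eqF.
rewrite powRM ?lp_ge0 ?invr_ge0 ?(ltW th0)// powRV ?(ltW th0)// mulrA ler_pdivlMr//.
rewrite -mean -sum1_card natr_sum mulr_suml big_mkcond /=; apply: ler_sum => w _.
rewrite inE; case: ifP => [h|_]; first by rewrite mul1r ltW.
by rewrite mulr_ge0 ?invr_ge0 ?(ltW s0') ?sumr_ge0// => t _; apply: powR_ge0.
Qed.

End Sampling.

(** * The threshold algorithm *)

Section ThresholdAlgorithm.
Context {R : realType} (k : base_field) (N1 N2 : nat).
Hypotheses (N10 : (0 < N1)%N) (N20 : (0 < N2)%N).
Local Notation K := (Defs.scalar R k).
Local Notation P := ('I_N1 * 'I_N2)%type.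
Local Notation X := ('M[K]_(N1, N2)).
Variables (ep r : R) (q u : \bar R).
Local Notation p := (ep%:E).
Local Notation v := (r%:E).
Hypotheses (p1 : 1 <= ep) (v1 : 1 <= r) (pq : (p < q)%E) (vu : (v < u)%E).
Local Notation a := (inv_exp p - inv_exp q).
Local Notation b := (inv_exp u - inv_exp v).
Variables (h s : nat) (th tail : R).
Hypotheses (h0 : (0 < h)%N) (ph : ep <= h%:R) (s0 : (0 < s)%N).
Hypotheses (th0 : 0 < th) (tail0 : 0 < tail).

Local Notation points := {ffun 'I_s -> 'I_N2}.
Local Notation seeds := {ffun 'I_h -> points}.

Definition exceeds (g : P -> K) (i : 'I_N1) : {set points} :=
  [set w : points | th `^ r < s%:R^-1 * \sum_t modulus (g (i, w t)) `^ r].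

(** A row is read completely when all h independent estimates of its norm exceed the
    threshold. One estimate obeys Markov's inequality with exponent r only;
    h of them together give the exponent r * h, which is at least p. The same
    sampling points serve all rows, since only expectations and a union bound are
    taken over the rows. *)
Definition selected (w : seeds) (g : P -> K) (i : 'I_N1) : bool :=
  [forall l, w l \in exceeds g i].

Definition probes (w : seeds) : seq P :=
  [seq (x.1.1, w x.1.2 x.2) | x : 'I_N1 * 'I_h * 'I_s].

Definition chosen (w : seeds) (g : P -> K) : seq P :=
  enum [set x : P | selected w g x.1].

Lemma chosen_local w (g g' : P -> K) :
  {in probes w, g =1 g'} -> chosen w g = chosen w g'.
Proof.
move=> gg; apply: eq_enum => x; rewrite !inE; apply: eq_forallb => l.
rewrite !inE; congr (_ < _ * _); apply: eq_bigr => t _.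
by rewrite gg//; apply/mapP; exists (x.1, l, t); rewrite ?mem_enum.
Qed.

Lemma size_probes w : size (probes w) = (N1 * h * s)%N.
Proof. by rewrite size_image !card_prod !card_ord. Qed.

Lemma size_chosen w g : size (chosen w g) = (#|[set i | selected w g i]| * N2)%N.
Proof.
rewrite -cardE -[N2 in RHS]card_ord -cardsT -cardsX; apply: eq_card => x.
by rewrite !inE andbT.
Qed.

Lemma card_selected g i :
  #|[set w : seeds | selected w g i]| = (#|exceeds g i| ^ h)%N.
Proof.
rewrite -[h in RHS]card_ord -card_ffun_on -[RHS]cardsE; apply: eq_card => w.
by rewrite !inE; apply/forallP/ffun_onP.
Qed.

Lemma card_seeds : #|{: seeds}|%:R = (N2%:R ^+ s) ^+ h :> R.
Proof. by rewrite card_ffun card_ord natrX card_samples. Qed.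

Variable f : X.
Hypothesis Ff : mixed_norm p u f <= 1.

Let row_v i := lp v (fun j => modulus (f i j)).
Let row_u i := lp u (fun j => modulus (f i j)).

Let u1 : (1 <= u)%E.
Proof. by apply: le_trans (ltW vu); rewrite lee_fin. Qed.

Let q1 : (1 <= q)%E.
Proof. by apply: le_trans (ltW pq); rewrite lee_fin. Qed.

Let p1' : (1 <= p)%E. Proof. by rewrite lee_fin. Qed.
Let v1' : (1 <= v)%E. Proof. by rewrite lee_fin. Qed.

Let row_v_ge0 i : 0 <= row_v i. Proof. exact: lp_ge0. Qed.
Let row_u_ge0 i : 0 <= row_u i. Proof. exact: lp_ge0. Qed.

Lemma row_u_norm : lp p row_u <= 1.
Proof. by move: Ff; rewrite mixedE. Qed.

Lemma row_v_norm : lp p row_v <= 1.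
Proof.
apply: le_trans row_u_norm; apply: lp_le => // i.
by apply: lp_mono => //; [apply: ltW|move=> j; apply: modulus_ge0].
Qed.

Lemma selected_rarely i : #|[set w : seeds | selected w (entry f) i]|%:R
  <= #|{: seeds}|%:R * (row_v i / th) `^ ep.
Proof.
have ep0 : 0 < ep by apply: lt_le_trans p1.
have rp0 : 0 < r by apply: lt_le_trans v1.
have x0 : 0 <= row_v i / th by rewrite divr_ge0// ltW.
have Ns : 0 <= N2%:R ^+ s :> R by rewrite exprn_ge0.
have [lx|xl] := leP 1 (row_v i / th).
  apply: (@le_trans _ _ #|{: seeds}|%:R); first by rewrite ler_nat max_card.
  rewrite ler_peMr// -[leLHS](powRr0 (row_v i / th)).
  by apply: ler_powR => //; apply: ltW.
rewrite card_selected natrX card_seeds.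
apply: (@le_trans _ _ ((N2%:R ^+ s * (row_v i / th) `^ r) ^+ h)).
  apply: lerXn2r; rewrite ?nnegrE ?ler0n ?mulr_ge0 ?powR_ge0//.
  exact: (@sampling_exceeds_rarely R N2 s N20 r (fun j => modulus (f i j)) th v1 s0
    th0 (fun j => modulus_ge0 _)).
rewrite exprMn; apply: ler_wpM2l; first by rewrite exprn_ge0.
rewrite -powR_mulrn ?powR_ge0// -powRrM.
have [->|xn0] := eqVneq (row_v i / th) 0.
  by rewrite !powR0 ?mulf_neq0 ?pnatr_eq0 -?lt0n ?gt_eqF// h0.
apply: ger_powR; first by rewrite lt_neqAle eq_sym xn0 x0 ltW.
by apply: le_trans ph _; rewrite ler_peMl.
Qed.

(** The number of rows that are read is controlled by the p-norm of the row norms. *)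
Lemma selected_total : \sum_w #|[set i | selected w (entry f) i]|%:R
  <= #|{: seeds}|%:R * (N1%:R * th `^ (- ep)).
Proof.
have N1' : 0 < N1%:R :> R by rewrite ltr0n.
have -> : \sum_w #|[set i | selected w (entry f) i]|%:R
    = \sum_i #|[set w : seeds | selected w (entry f) i]|%:R :> R.
  under eq_bigr do rewrite -sum1_card natr_sum big_mkcond.
  under [RHS]eq_bigr do rewrite -sum1_card natr_sum big_mkcond.
  by rewrite exchange_big; apply: eq_bigr => i _; apply: eq_bigr => w _; rewrite !inE.
apply: (le_trans (ler_sum _ (fun i _ => selected_rarely i))).
rewrite -mulr_sumr; apply: ler_wpM2l => //.
under eq_bigr do rewrite powRM ?invr_ge0 ?(ltW th0)//.
rewrite -mulr_suml powRV ?(ltW th0)// -powRN; apply: ler_wpM2r; first exact: powR_ge0.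
have -> : \sum_i row_v i `^ ep = N1%:R * lp p row_v `^ ep.
  by rewrite (lp_pow p1 row_v_ge0) mulVKf// gt_eqF.
have hv : lp p row_v `^ ep <= 1.
  apply: powR_le1; [exact: le_trans p1|exact: lp_ge0|exact: row_v_norm].
by rewrite -[leRHS]mulr1; apply: ler_wpM2l.
Qed.

(** The rows that may be left out: below the threshold, or too irregular for s
    samples to notice them. *)
Definition small (i : 'I_N1) : bool :=
  (row_v i <= 8 * th) ||
  (row_v i <= 2 * row_u i * (s%:R / (8 * tail)) `^ b).

Definition missing (w : seeds) : bool :=
  [exists i, ~~ selected w (entry f) i && ~~ small i].

(** Bernoulli's inequality, for the h independent estimates to exceed the threshold
    simultaneously. *)
Lemma unselected_rarely i : ~~ small i ->
  #|[set w : seeds | ~~ selected w (entry f) i]|%:R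
    <= #|{: seeds}|%:R * (h%:R * 2 `^ (- tail)).
Proof.
rewrite negb_or -!ltNge => /andP[s1 s2].
have x0 j : 0 <= modulus (f i j) by apply: modulus_ge0.
have a0 : 0 < row_v i by apply: le_lt_trans s1; rewrite mulr_ge0// ltW.
have := @sampling_misses_rarely R N2 s N20 r u (fun j => modulus (f i j)) th tail
  v1 vu s0 tail0 (ltW th0) x0 a0 (ltW s1).
rewrite -[r^-1]inv_expE => /(_ (ltW s2)).
set del := 2 `^ _; have del1 : del <= 1.
  rewrite -[leRHS](powRr0 2); apply: ler_powR; rewrite ?ler1n//.
  by rewrite oppr_le0 ltW.
set M := [set w | _] => hM.
have Mc : ~: M = exceeds (entry f) i.
  by apply/setP => w; rewrite !inE -ltNge.
have N0 : 0 < N2%:R ^+ s :> R by rewrite exprn_gt0// ltr0n.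
have good : N2%:R ^+ s * (1 - del) <= #|exceeds (entry f) i|%:R.
  rewrite mulrBr mulr1 lerBlDr -Mc -[leLHS](card_samples N2 s) -(cardsC M) natrD.
  by rewrite addrC lerD2l.
have bern m : 1 - m%:R * del <= (1 - del) ^+ m.
  have d0 : 0 <= del by apply: powR_ge0.
  elim: m => [|m IH]; first by rewrite mul0r subr0 expr0.
  rewrite exprS; apply: le_trans (ler_wpM2l _ IH); last by rewrite subr_ge0.
  rewrite -natr1; have : 0 <= m%:R * del * del by rewrite !mulr_ge0.
  by lra.
have goodh : #|{: seeds}|%:R * (1 - h%:R * del)
    <= #|[set w : seeds | selected w (entry f) i]|%:R.
  rewrite card_selected natrX card_seeds.
  apply: (@le_trans _ _ ((N2%:R ^+ s * (1 - del)) ^+ h)).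
    rewrite exprMn; apply: ler_wpM2l; first by rewrite exprn_ge0// ltW.
    exact: bern.
  by apply: lerXn2r; rewrite ?nnegrE ?mulr_ge0 ?subr_ge0 ?(ltW N0).
have -> : [set w : seeds | ~~ selected w (entry f) i]
    = ~: [set w : seeds | selected w (entry f) i].
  by apply/setP => w; rewrite !inE.
have := cardsC [set w : seeds | selected w (entry f) i].
move/(congr1 (fun m => m%:R : R)); rewrite natrD => cE.
have -> : #|~: [set w : seeds | selected w (entry f) i]|%:R
   = #|{: seeds}|%:R - #|[set w : seeds | selected w (entry f) i]|%:R :> R.
  by rewrite -[in RHS]cE addrAC subrr add0r.
by rewrite lerBlDr -lerBlDl; move: goodh; rewrite mulrBr mulr1.
Qed.

Lemma missing_rarely : #|[set w | missing w]|%:R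
  <= #|{: seeds}|%:R * (N1%:R * (h%:R * 2 `^ (- tail))).
Proof.
pose M i := if small i then finset.set0 else [set w : seeds | ~~ selected w (entry f) i].
apply: (@le_trans _ _ (\sum_i #|M i|%:R)).
  have cM i : #|M i|%:R = \sum_(w : seeds) (w \in M i)%:R :> R.
    rewrite -sum1_card natr_sum big_mkcond; apply: eq_bigr => w _.
    by case: (w \in M i).
  rewrite (eq_bigr _ (fun i _ => cM i)) exchange_big /=.
  rewrite -sum1_card natr_sum big_mkcond; apply: ler_sum => w _.
  rewrite inE; case: ifP => [/existsP[i /andP[si li]]|_]; last exact: sumr_ge0.
  by rewrite (bigD1 i) //= /M (negbTE li) inE si lerDl sumr_ge0.
rewrite mulrCA [leRHS]mulr_natl -[X in _ *+ X]card_ord -sumr_const.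
apply: ler_sum => i _; rewrite /M; case: ifPn => [_|]; last exact: unselected_rarely.
by rewrite cards0 !mulr_ge0// powR_ge0.
Qed.

Let approx (w : seeds) : X := \matrix_(i, j)
  if (i, j) \in chosen w (entry f) then f i j else 0.

Lemma a_ge0 : 0 <= a.
Proof. by rewrite subr_ge0 inv_exp_le// ltW. Qed.

Lemma pos_part_a : pos_part a = a.
Proof. by apply: max_l; exact: a_ge0. Qed.

Lemma residual_row w i : lp v (fun j => modulus ((f - approx w) i j))
  = if selected w (entry f) i then 0 else row_v i.
Proof.
case: ifPn => si.
  rewrite (_ : (fun j => _) = fun j => 0 * 0); first by rewrite lp_scale// mul0r.
  by apply/funext => j; rewrite !mxE mem_enum inE si subrr modulus0 mul0r.
congr lp; apply/funext => j.
by rewrite !mxE mem_enum inE (negbTE si) subr0.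
Qed.

(** The worst case, when a row has been missed. *)
Lemma residual_bound w : mixed_norm q v (f - approx w) <= N1%:R `^ a.
Proof.
rewrite mixedE; apply: (@le_trans _ _ (lp q row_v)).
  apply: (lp_le q1) => i; first exact: lp_ge0.
  rewrite residual_row; case: ifP => _; [exact: row_v_ge0|exact: lexx].
apply: le_trans (lp_embed N10 p1' q1 row_v_ge0) _.
rewrite pos_part_a -[leRHS]mulr1.
by apply: ler_wpM2l; [exact: powR_ge0|exact: row_v_norm].
Qed.

(** Rows below the threshold contribute by interpolation, irregular rows by the
    embedding of the u-norms. *)
Lemma residual_small w : ~~ missing w -> mixed_norm q v (f - approx w)
  <= (8 * th) `^ (ep * a) + 2 * (s%:R / (8 * tail)) `^ b * N1%:R `^ a.
Proof.
move=> nm; rewrite mixedE; set S := _ `^ b.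
have S0 : 0 <= S by apply: powR_ge0.
pose low i := Num.min (row_v i) (8 * th).
have th8 : 0 <= 8 * th by rewrite mulr_ge0// ltW.
have low0 i : 0 <= low i by rewrite le_min row_v_ge0.
apply: (@le_trans _ _ (lp q (fun i => low i + 2 * S * row_u i))).
  apply: (lp_le q1) => i; first exact: lp_ge0.
  rewrite residual_row; case: ifPn => si.
    by rewrite addr_ge0// !mulr_ge0.
  have : small i.
    by apply: contraNT nm => ns; apply/existsP; exists i; rewrite si.
  case/orP => [h8|hS]; first by rewrite /low min_l// lerDl !mulr_ge0.
  by apply: le_trans hS _; rewrite mulrAC -/S lerDr.
apply: le_trans (lp_add q1 low0 _) _; first by move=> i; rewrite !mulr_ge0.
apply: lerD.
  have low8 i : low i <= 8 * th by rewrite ge_min lexx orbT.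
  have lown : lp p low <= 1.
    apply: le_trans row_v_norm; apply: lp_le => // i; by rewrite ge_min lexx.
  exact: (lp_interp N10 p1' pq th8 low0 low8 lown).
rewrite lp_scale ?mulr_ge0//; apply: ler_wpM2l; first by rewrite mulr_ge0.
apply: le_trans (lp_embed N10 p1' q1 row_u_ge0) _.
rewrite pos_part_a -[leRHS]mulr1.
by apply: ler_wpM2l; [exact: powR_ge0|exact: row_u_norm].
Qed.

Lemma residual_total : \sum_w mixed_norm q v (f - approx w) <=
  ((8 * th) `^ (ep * a) + 2 * (s%:R / (8 * tail)) `^ b * N1%:R `^ a
   + N1%:R * (h%:R * 2 `^ (- tail)) * N1%:R `^ a) * #|{: seeds}|%:R.
Proof.
set C := _ + 2 * _ * _.
have C0 : 0 <= C by rewrite addr_ge0 ?mulr_ge0 ?powR_ge0.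
have NA : 0 <= N1%:R `^ a by apply: powR_ge0.
apply: (@le_trans _ _ (\sum_(w : seeds) (C + (missing w)%:R * N1%:R `^ a))).
  apply: ler_sum => w _; have [m|m] := boolP (missing w).
    by rewrite mul1r; apply: le_trans (residual_bound w) _; rewrite lerDr.
  by rewrite mul0r addr0; apply: residual_small.
rewrite big_split /= sumr_const -mulr_suml [X in _ <= X]mulrDl.
apply: lerD; first by rewrite mulr_natr.
rewrite [leRHS]mulrAC; apply: ler_wpM2r => //.
rewrite [leRHS]mulrC; apply: le_trans missing_rarely.
rewrite -sum1_card natr_sum [leRHS]big_mkcond /=; apply: ler_sum => w _.
by rewrite inE; case: ifP.
Qed.

End ThresholdAlgorithm.

(** * The upper bounds *)

Section UpperBounds.
Context {R : realType} (k : base_field) (N1 N2 : nat).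
Hypotheses (N10 : (0 < N1)%N) (N20 : (0 < N2)%N).
Local Notation X := ('M[Defs.scalar R k]_(N1, N2)).

Let pt : 'I_N1 * 'I_N2 := (Ordinal N10, Ordinal N20).

(** Attained without any information, by the output 0. *)
Lemma upper_embedding (p q u v : \bar R) n :
  (1 <= p)%E -> (1 <= q)%E -> (1 <= u)%E -> (1 <= v)%E ->
  (e_ran_non_J k p q u v n N1 N2 <=
    (N1%:R `^ pos_part (inv_exp p - inv_exp q)
      * N2%:R `^ pos_part (inv_exp u - inv_exp v))%:E)%E.
Proof.
move=> p1 q1 u1 v1.
pose no (g : 'I_N1 * 'I_N2 -> Defs.scalar R k) : seq ('I_N1 * 'I_N2) := [::].
have no_local (g g' : 'I_N1 * 'I_N2 -> Defs.scalar R k) :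
  {in [::], g =1 g'} -> no g = no g' by [].
pose A (w : unit) := two_phase pt [::] no.
have W0 : (0 < #|{: unit}|)%N by rewrite card_unit.
pose E := N1%:R `^ pos_part (inv_exp p - inv_exp q)
  * N2%:R `^ pos_part (inv_exp u - inv_exp v) : R.
have stopA (w : unit) (f : X) : unit_ball p u f -> stop_time (A w) f = Some 0%N.
  by move=> _; rewrite (stop_two_phase pt no_local).
have costA (f : X) : unit_ball p u f -> (\sum_(w : unit) 0 <= n * #|{: unit}|)%N.
  by rewrite big1.
have runA f : run (A tt) f = 0.
  by rewrite /A (run_two_phase pt no_local); apply/matrixP => i j; rewrite !mxE.
have errA (f : X) : unit_ball p u f ->
    \sum_w mixed_norm q v (idfun f - run (A w) f) <= E * #|{: unit}|%:R.
  move=> Ff; rewrite card_unit mulr1 (bigD1 tt)// big1; last by case.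
  rewrite runA subr0 /= addr0; apply: le_trans (mixed_embed f N10 N20 p1 q1 u1 v1) _.
  by rewrite -/E -[leRHS]mulr1; apply: ler_wpM2l; rewrite ?mulr_ge0 ?powR_ge0.
have [B [_ errB nonB]] := finite_randomization (mixed0 N1 N2 q1 v1)
  (@mixed_ge0 R k N1 N2 q v) W0 stopA costA errA.
apply: le_trans errB; apply: ereal_inf_lbound; exists B => //; apply: nonB => w.
by split=> i y z //=; rewrite /next /= !nth_nil.
Qed.

Lemma e_ran_le_non (p q u v : \bar R) n :
  (e_ran_J k p q u v n N1 N2 <= e_ran_non_J k p q u v n N1 N2)%E.
Proof. by apply: ereal_inf_le_tmp => _ [A [clsA _] <-]; exists A. Qed.

Lemma upper_threshold (ep r : R) (q u : \bar R) (h s n : nat) (th tail : R) :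
  1 <= ep -> 1 <= r -> (ep%:E < q)%E -> (r%:E < u)%E ->
  (0 < h)%N -> ep <= h%:R -> (0 < s)%N -> 0 < th -> 0 < tail ->
  (N1 * h * s)%:R + N1%:R * th `^ (- ep) * N2%:R <= n%:R ->
  (e_ran_J k ep%:E q u r%:E n N1 N2 <=
    ((8 * th) `^ (ep * (inv_exp ep%:E - inv_exp q)) +
     2 * (s%:R / (8 * tail)) `^ (inv_exp u - inv_exp r%:E) *
       N1%:R `^ (inv_exp ep%:E - inv_exp q) +
     N1%:R * (h%:R * 2 `^ (- tail)) * N1%:R `^ (inv_exp ep%:E - inv_exp q))%:E)%E.
Proof.
move=> p1 r1 pq ru h0 ph s0 th0 tail0 budget; set E := _ + _ + _.
have q1 : (1 <= q)%E by apply: le_trans (ltW pq); rewrite lee_fin.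
have v1 : (1 <= r%:E)%E by rewrite lee_fin.
pose W : finType := {ffun 'I_h -> {ffun 'I_s -> 'I_N2}}.
pose A (w : W) := two_phase pt (probes N1 w) (@chosen R k N1 N2 r h s th w).
have loc w := @chosen_local R k N1 N2 r h s th w.
have W0 : (0 < #|W|)%N.
  by apply/card_gt0P; exists [ffun=> [ffun=> Ordinal N20]].
pose cost_of (w : W) (f : X) :=
  (N1 * h * s + #|[set i | selected r th w (entry f) i]| * N2)%N.
have stopA (w : W) (f : X) : unit_ball ep%:E u f ->
    stop_time (A w) f = Some (cost_of w f).
  by move=> _; rewrite (stop_two_phase pt (loc w)) size_probes size_chosen.
have costA (f : X) : unit_ball ep%:E u f ->
    (\sum_w cost_of w f <= n * #|W|)%N.
  move=> Ff; rewrite -(ler_nat R) natr_sum natrM.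
  rewrite (eq_bigr (fun w => (N1 * h * s)%:R
      + #|[set i | selected r th w (entry f) i]|%:R * N2%:R)); last first.
    by move=> w _; rewrite natrD -natrM.
  rewrite big_split /= -mulr_suml sumr_const -[X in X + _]mulr_natr.
  apply: le_trans (ler_wpM2r _ budget) => //.
  rewrite mulrDl lerD2l [leRHS]mulrAC; apply: ler_wpM2r => //.
  rewrite mulrC; exact: (selected_total N10 N20 p1 r1 ru h0 ph s0 th0 Ff).
have errA (f : X) : unit_ball ep%:E u f ->
    \sum_w mixed_norm q r%:E (idfun f - run (A w) f) <= E * #|W|%:R.
  move=> Ff; apply: le_trans
    (residual_total N10 N20 p1 r1 pq ru h s0 th0 tail0 Ff).
  by apply: ler_sum => w _; rewrite (run_two_phase pt (loc w)).
have [B [clsB errB _]] := finite_randomization (mixed0 N1 N2 q1 v1)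
  (@mixed_ge0 R k N1 N2 q r%:E) W0 stopA costA errA.
by apply: le_trans errB; apply: ereal_inf_lbound; exists B.
Qed.

Lemma powR2_log2 (y : R) : 0 < y -> 2 `^ log2 y = y.
Proof.
move=> y0; have l2 : ln 2 != 0 :> R by rewrite gt_eqF// ln_gt0// ltr1n.
by rewrite /powR pnatr_eq0 /= /log2 divfK// lnK.
Qed.

Lemma log2_ge1 (y : R) : 2 <= y -> 1 <= log2 y.
Proof.
move=> y2; have l2 : 0 < ln 2 :> R by rewrite ln_gt0// ltr1n.
rewrite /log2 ler_pdivlMr// mul1r ler_ln// posrE//.
exact: lt_le_trans y2.
Qed.

(** The error on the rows below the threshold, with y = n / N2: for the base
    2 * A / y the expected number of rows read is y / 2 when A = N1. *)
Lemma threshold_term (ep e A y c : R) : 0 < ep -> 0 < A -> 1 <= y ->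
  0 < c -> c <= 2 * y -> 0 <= e -> e <= 1 -> ep * e <= 1 ->
  (8 * (2 * A / y) `^ ep^-1) `^ (ep * e) <= 32 * (A `^ e * c `^ (- e)).
Proof.
move=> ep0 A0 y1 c0 cy e0 e1 epe.
have y0 : 0 < y by apply: lt_le_trans y1.
have two (x z : R) : 1 <= x -> z <= 1 -> x `^ z <= x.
  move=> x1 z1; rewrite -[leRHS]powRr1; last exact: le_trans x1.
  exact: ler_powR.
have K0 : 0 <= 2 * A / y by rewrite !mulr_ge0 ?invr_ge0// ltW.
have -> : (8 * (2 * A / y) `^ ep^-1) `^ (ep * e)
    = 8 `^ (ep * e) * (A `^ e * (2 `^ e * y `^ (- e))).
  rewrite powRM ?powR_ge0// -powRrM mulKf ?gt_eqF//.
  rewrite !powRM ?mulr_ge0 ?invr_ge0 ?(ltW A0) ?(ltW y0)//.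
  by rewrite powRV ?(ltW y0)// powRN -mulrA (mulrCA (A `^ e)).
have ye : y `^ (- e) <= 2 * c `^ (- e).
  by apply: ler_powR_scale; rewrite ?ler1n ?lerN2 ?oppr_le0.
have h8 : 8 `^ (ep * e) <= 8 :> R by apply: two; rewrite ?ler1n.
have h2 : 2 `^ e * y `^ (- e) <= 2 * (2 * c `^ (- e)).
  by apply: ler_pM; rewrite ?powR_ge0//; apply: two; rewrite ?ler1n.
apply: (@le_trans _ _ (8 * (A `^ e * (2 * (2 * c `^ (- e)))))).
  apply: ler_pM; rewrite ?mulr_ge0 ?powR_ge0//.
  by apply: ler_wpM2l; rewrite ?powR_ge0.
lra.
Qed.

(** The error on the irregular rows, with y = n / (N1 l) and S proportional to the
    number of samples per unit of the exponent of the failure probability. *)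
Lemma sample_term (H y S c e : R) : 1 <= H -> 1 <= y -> 0 < S ->
  y / (32 * H * (H + 2)) <= S -> 0 < c -> c <= 2 * y -> -1 <= e -> e <= 0 ->
  S `^ e <= 64 * H * (H + 2) * c `^ e.
Proof.
move=> H1 y1 S0 yS c0 cy e1 e0; have H0 : 0 < H by apply: lt_le_trans H1.
have H2 : 1 <= H * (H + 2) by apply: (le_trans H1); rewrite ler_peMr//; lra.
have P0 : 0 < 32 * H * (H + 2) by rewrite -mulrA mulr_gt0//; lra.
apply: ler_powR_scale => //; first by lra.
by move: yS; rewrite ler_pdivrMr// => yS; lra.
Qed.

(** This is where the logarithm of N1 + N2 enters: it makes the failure probability
    so small that the union bound over all rows and groups leaves the factor
    1 / (N1 + N2), which is below the other terms of the bound. *)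
Lemma miss_term (h : nat) :
  N1%:R * (h%:R * 2 `^ (- ((h%:R + 2) * log2 (N1 + N2)%:R))) <= (N1 + N2)%:R^-1 :> R.
Proof.
set M : R := (N1 + N2)%:R; have M0 : 0 < M by rewrite ltr0n addn_gt0 N10.
have -> : 2 `^ (- ((h%:R + 2) * log2 M)) = (M ^+ h * (M * M))^-1.
  rewrite powRN mulrC powRrM powR2_log2// -natrD powR_mulrn ?(ltW M0)//.
  by rewrite exprD expr2.
have hM : h%:R <= M ^+ h.
  rewrite -natrX ler_nat; apply: (leq_trans (ltnW (ltn_expl h (ltnSn 1)))).
  by case: (h) => [|h1]; rewrite ?expn0 ?leq_exp2r ?(leq_add N10 N20).
have NM : N1%:R <= M by rewrite ler_nat leq_addr.
rewrite mulrA ler_pdivrMr ?mulr_gt0 ?exprn_gt0// mulrCA mulKf ?gt_eqF// mulrC.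
exact: ler_pM.
Qed.

(** The budget is split evenly: s sampling points for each of the h groups, and
    a threshold so high that the expected number of rows read is at most
    n / (2 N2). When n is too small for this, the bound is of the same order as
    the norm of the embedding. *)
Lemma upper_adaptive (ep r : R) (q u : \bar R) (h n : nat) :
  1 <= ep -> 1 <= r -> (ep%:E < q)%E -> (r%:E < u)%E ->
  (0 < h)%N -> ep <= h%:R -> (0 < n)%N -> (n <= N1 * N2)%N ->
  (e_ran_J k ep%:E q u r%:E n N1 N2 <=
    ((33 + 128 * h%:R * (h%:R + 2)) * N1%:R `^ (inv_exp ep%:E - inv_exp q) *
      (rceil (n%:R / (N1%:R * log2 (N1 + N2)%:R)) `^ (inv_exp u - inv_exp r%:E) +
       rceil (n%:R / (N2%:R * log2 (N1 + N2)%:R))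
         `^ (- (inv_exp ep%:E - inv_exp q))))%:E)%E.
Proof.
move=> p1 r1 pq ru h0 ph n0 nN.
have [a aE] : {a : R | a = inv_exp ep%:E - inv_exp q} by eexists.
have [b bE] : {b : R | b = inv_exp u - inv_exp r%:E} by eexists.
have [l lE] : {l : R | l = log2 (N1 + N2)%:R} by eexists.
rewrite -aE -bE -lE.
have N1' : 0 < N1%:R :> R by rewrite ltr0n.
have N2' : 0 < N2%:R :> R by rewrite ltr0n.
have n' : 0 < n%:R :> R by rewrite ltr0n.
have h' : 1 <= h%:R :> R by rewrite ler1n.
have h0' : 0 < h%:R :> R by rewrite ltr0n.
have ep0 : 0 < ep by apply: lt_le_trans p1.
have p1' : (1 <= ep%:E)%E by rewrite lee_fin.
have v1' : (1 <= r%:E)%E by rewrite lee_fin.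
have q1 : (1 <= q)%E by apply: le_trans (ltW pq).
have u1 : (1 <= u)%E by apply: le_trans (ltW ru).
have l1 : 1 <= l by rewrite lE; apply: log2_ge1; rewrite ler_nat (leq_add N10 N20).
have l0 : 0 < l by apply: lt_le_trans l1.
have /andP[a0 a1] : 0 <= a <= 1 by rewrite aE; apply: inv_exp_sub_itv => //; apply: ltW.
have /andP[b1 b0] : -1 <= b <= 0.
  by rewrite bE -opprB lerN2 oppr_le0 andbC; apply: inv_exp_sub_itv => //; apply: ltW.
have [c1 [c10 -> _ c1n]] := rceil_nat (divr_gt0 n' (mulr_gt0 N1' l0)).
have [c2 [c20 -> _ c2n]] := rceil_nat (divr_gt0 n' (mulr_gt0 N2' l0)).
have [y1 y1E] : {y : R | y = n%:R / (N1%:R * l)} by eexists.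
have [y2 y2E] : {y : R | y = n%:R / N2%:R} by eexists.
rewrite -y1E in c1n.
have {}c2n : c2%:R < y2 + 1.
  apply: lt_le_trans c2n _; rewrite lerD2r y2E ler_pM2l// lef_pV2 ?posrE ?mulr_gt0//.
  by rewrite ler_peMr// ltW.
have c1' : 0 < c1%:R :> R by rewrite ltr0n.
have c2' : 0 < c2%:R :> R by rewrite ltr0n.
set A := N1%:R `^ a; have A0 : 0 < A by rewrite powR_gt0.
set U := c1%:R `^ b; have U0 : 0 <= U by apply: powR_ge0.
set V := c2%:R `^ (- a); have V0 : 0 <= V by apply: powR_ge0.
(* 33 = 32 + 1 from the threshold and the missed rows, 128 = 2 * 64 from the
   irregular ones. *)
set C := 33 + _.
have hh : 1 <= h%:R * h%:R :> R by apply: (le_trans h'); rewrite ler_peMr// ltW.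
have C_ge (x : R) : x <= 33 \/ x <= 5 * h%:R -> x <= C.
  by move=> []; rewrite /C; lra.
have trivial_alg : 1 <= C * (U + V) ->
    (e_ran_J k ep%:E q u r%:E n N1 N2 <= (C * A * (U + V))%:E)%E.
  move=> big; apply: (le_trans (e_ran_le_non _ _ _ _ _)).
  apply: (le_trans (upper_embedding _ p1' q1 u1 v1')).
  rewrite lee_fin -aE -bE /pos_part max_l// max_r// powRr0 mulr1.
  by rewrite mulrAC ler_peMl// ltW.
have C0 : 0 <= C by apply: C_ge; left.
have [few1|many1] := ltP y1 (4 * h%:R).
  apply: trivial_alg; apply: (@le_trans _ _ (C * U)); last first.
    by apply: ler_wpM2l; rewrite ?lerDl.
  apply: (@le_trans _ _ (5 * h%:R * U)); last first.
    by apply: ler_wpM2r => //; apply: C_ge; right.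
  rewrite -[leLHS](_ : 1 `^ b = 1); last by rewrite powR1.
  by apply: ler_powR_scale => //; lra.
have [few2|many2] := ltP y2 1.
  apply: trivial_alg; apply: (@le_trans _ _ (C * V)); last first.
    by apply: ler_wpM2l; rewrite ?lerDr.
  apply: (@le_trans _ _ (2 * V)); last first.
    by apply: ler_wpM2r => //; apply: C_ge; left; lra.
  rewrite -[leLHS](_ : 1 `^ (- a) = 1); last by rewrite powR1.
  by apply: ler_powR_scale => //; lra.
pose s := (n %/ (2 * N1 * h))%N; pose D : R := 2 * N1%:R * h%:R.
have D0 : 0 < D by rewrite !mulr_gt0.
have DE : (2 * N1 * h)%:R = D by rewrite !natrM.
have D2 : D + D <= n%:R.
  have : 4 * h%:R * (N1%:R * 1) <= 4 * h%:R * (N1%:R * l).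
    by rewrite !ler_pM2l ?mulr_gt0.
  by move: many1; rewrite y1E ler_pdivlMr ?mulr_gt0// /D; lra.
have sD : s%:R * D <= n%:R by rewrite -DE -natrM ler_nat leq_trunc_div.
have Ds : n%:R < (s%:R + 1) * D.
  rewrite natr1 -DE -natrM ltr_nat ltn_ceil//.
  by rewrite !muln_gt0 N10 h0.
have s0 : (0 < s)%N.
  rewrite lt0n; apply/eqP => s00; move: Ds; rewrite s00 add0r mul1r; lra.
have sn : n%:R <= s%:R * (4 * N1%:R * h%:R) :> R.
  have -> : s%:R * (4 * N1%:R * h%:R) = s%:R * D + s%:R * D by rewrite /D; ring.
  apply: le_trans (ltW Ds) _; rewrite mulrDl lerD2l.
  by apply: ler_wpM2r; [apply: ltW|rewrite ler1n].
have y20 : 0 < y2 by apply: lt_le_trans many2.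
have K0 : 0 < 2 * N1%:R / y2 by rewrite divr_gt0// mulr_gt0.
pose th := (2 * N1%:R / y2) `^ ep^-1; have th0 : 0 < th by rewrite powR_gt0.
pose tail := (h%:R + 2) * l.
have h2 : 0 < h%:R + 2 :> R by rewrite addr_gt0.
have tail0 : 0 < tail by rewrite mulr_gt0.
have budget : (N1 * h * s)%:R + N1%:R * th `^ (- ep) * N2%:R <= n%:R :> R.
  have -> : N1%:R * th `^ (- ep) * N2%:R = n%:R / 2.
    by rewrite powRN powRKV// ?(ltW K0)// y2E; field; rewrite !gt_eqF.
  by move: sD; rewrite /D !natrM; lra.
apply: (le_trans (upper_threshold p1 r1 pq ru h0 ph s0 th0 tail0 budget)).
rewrite lee_fin -aE -bE -/A.
have T1 : (8 * th) `^ (ep * a) <= 32 * (A * V).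
  apply: threshold_term => //; first by lra.
  rewrite aE mulrBr inv_expE mulfV ?gt_eqF// gerBl mulr_ge0// ?(ltW ep0)//.
  by case/andP: (inv_exp_itv q1).
have T2 : (s%:R / (8 * tail)) `^ b <= 64 * h%:R * (h%:R + 2) * U.
  apply: (sample_term (y := y1)) => //; [lra| | |lra].
  - by rewrite divr_gt0 ?mulr_gt0// ltr0n.
  - rewrite y1E /tail.
    have -> : n%:R / (N1%:R * l) / (32 * h%:R * (h%:R + 2))
        = n%:R / (4 * N1%:R * h%:R) / (8 * ((h%:R + 2) * l)).
      by field; rewrite !gt_eqF.
    apply: ler_wpM2r; first by rewrite invr_ge0 !mulr_ge0// ltW.
    by rewrite ler_pdivrMr// !mulr_gt0.
have T3 : N1%:R * (h%:R * 2 `^ (- tail)) <= V.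
  rewrite /tail lE; apply: le_trans (miss_term h) _.
  apply: (@le_trans _ _ c2%:R^-1).
    rewrite lef_pV2 ?posrE// ?ltr0n ?addn_gt0 ?N10// ler_nat.
    apply: leq_trans (leq_addr N2 N1).
    rewrite -ltnS -(ltr_nat R) -natr1; apply: (lt_le_trans c2n).
    by rewrite lerD2r y2E ler_pdivrMr// -natrM ler_nat.
  rewrite -powR_inv1 ?(ltW c2')//; apply: ler_powR; first by rewrite ler1n.
  by rewrite lerN2.
apply: (@le_trans _ _
    (32 * (A * V) + 2 * (64 * h%:R * (h%:R + 2) * U) * A + V * A)).
  apply: lerD; first apply: lerD => //.
    by apply: ler_wpM2r; [exact: ltW|apply: ler_wpM2l].
  by apply: ler_wpM2r => //; exact: ltW.
have AU : 0 <= A * U by rewrite mulr_ge0// ltW.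
have AV : 0 <= h%:R * (h%:R + 2) * (A * V) by rewrite !mulr_ge0// ltW.
rewrite /C; lra.
Qed.

End UpperBounds.

Theorem theorem1 (R : realType) (k : base_field) (p q u v : \bar R)
  (hp : (1 <= p)%E) (hq : (1 <= q)%E) (hu : (1 <= u)%E) (hv : (1 <= v)%E) :
  exists c0 c1 c2 c3 c4 c5 c6 : R,
    [/\ 0 < c0, c0 < 1 &
        [/\ 0 < c1, 0 < c2, 0 < c3, 0 < c4 & 0 < c5 /\ 0 < c6]] /\
    forall n N1 N2 : nat, (0 < n)%N -> (0 < N1)%N -> (0 < N2)%N ->
    n%:R < c0 * N1%:R * N2%:R ->
    let a := inv_exp p - inv_exp q in
    let b := inv_exp u - inv_exp v in
    let l := log2 (N1 + N2)%:R in
    ((q <= p)%E \/ (u <= v)%E ->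
       [/\ ((c1 * N1%:R `^ pos_part a * N2%:R `^ pos_part b)%:E
             <= e_ran_J k p q u v n N1 N2)%E,
           (e_ran_J k p q u v n N1 N2 <= e_ran_non_J k p q u v n N1 N2)%E &
           (e_ran_non_J k p q u v n N1 N2
             <= (c2 * N1%:R `^ pos_part a * N2%:R `^ pos_part b)%:E)%E]) /\
    ((p < q)%E -> (v < u)%E ->
       [/\ ((c3 * N1%:R `^ a *
              (rceil (n%:R / N1%:R) `^ b + rceil (n%:R / N2%:R) `^ (- a)))%:E
             <= e_ran_J k p q u v n N1 N2)%E,
           (e_ran_J k p q u v n N1 N2
             <= (c4 * N1%:R `^ a *
                  (rceil (n%:R / (N1%:R * l)) `^ b +
                   rceil (n%:R / (N2%:R * l)) `^ (- a)))%:E)%E,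
           ((c5 * N1%:R `^ a)%:E <= e_ran_non_J k p q u v n N1 N2)%E &
           (e_ran_non_J k p q u v n N1 N2 <= (c6 * N1%:R `^ a)%:E)%E]).
Proof.
(* The number of groups only has to be at least p; for infinite p the threshold
   algorithm does not occur. *)
pose h := (Num.bound (fine p)).+1.
have ph : p = +oo%E \/ (fine p <= h%:R /\ p = (fine p)%:E).
  case/exponentP: hp => [[r pE r1]|->]; [right|by left].
  rewrite /h pE; split=> //; apply: ltW; apply: (@lt_le_trans _ _ (Num.bound r)%:R).
    by apply: archi_boundP; apply: le_trans r1.
  by rewrite ler_nat.
exists 6^-1, 3^-1, 1, 72^-1, (33 + 128 * h%:R * (h%:R + 2)), 3^-1, 1.
split.
  split; [by rewrite invr_gt0|by rewrite invf_lt1// ltr1n|].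
  by split; rewrite ?invr_gt0 ?ltr01//.
move=> n N1 N2 n0 N10 N20 hn a b l.
have n6 : (6 * n <= N1 * N2)%N.
  rewrite -(ler_nat R) !natrM; apply: ltW.
  by move: hn; rewrite -mulrA mulrC ltr_pdivlMr// mulrC.
split=> [hpq|pq vu].
  split; [exact: lower_embedding|exact: e_ran_le_non|].
  by rewrite mul1r; apply: upper_embedding.
have pE : p = (fine p)%:E /\ fine p <= h%:R.
  by case: ph pq => [->|[? ?]] //; rewrite ltNge leey.
have vE : v = (fine v)%:E.
  by case/exponentP: hv vu => [[r -> _]|->] //; rewrite ltNge leey.
split.
- exact: lower_adaptive.
- case: pE => pE ple; rewrite /a /b /l pE vE.
  rewrite pE lee_fin in hp; rewrite pE in pq; rewrite vE lee_fin in hv; rewrite vE in vu.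
  apply: upper_adaptive => //.
  by apply: leq_trans n6; rewrite leq_pmull.
- exact: e_ran_non_lower.
- rewrite mul1r; apply: le_trans (upper_embedding k N10 N20 n hp hq hu hv) _.
  rewrite lee_fin /pos_part max_l ?subr_ge0 ?inv_exp_le ?(ltW pq)//.
  by rewrite max_r ?subr_le0 ?inv_exp_le ?(ltW vu)// powRr0 mulr1.
Qed.
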